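(* The canonical image of $\operatorname{Aut}(\mathcal{Q}_2,\mathcal{O}_2)$ in $\operatorname{Out}(\mathcal{Q}_2)$ is non-abelian.
   Context: The 2-adic ring $C^*$-algebra $\mathcal{Q}_2$ is the universal unital $C^*$-algebra generated by a unitary $u$ and an isometry $s_2$ with $s_2u=u^2s_2$ and $s_2s_2^*+us_2s_2^*u^*=1$. Put $s_1:=us_2$; then $\mathcal{O}_2:=C^*(s_1,s_2)\subseteq\mathcal{Q}_2$ is the canonical copy of the Cuntz algebra. $\operatorname{Aut}(\mathcal{Q}_2,\mathcal{O}_2)=\{\phi\in\operatorname{Aut}(\mathcal{Q}_2):\phi(\mathcal{O}_2)=\mathcal{O}_2\}$. $\operatorname{Out}(\mathcal{Q}_2)$ is the quotient of $\operatorname{Aut}(\mathcal{Q}_2)$ by the normal subgroup of inner automorphisms $\operatorname{Ad}(w)(x)=wxw^*$, $w$ a unitary of $\mathcal{Q}_2$. *)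

(* Defs.v *)
From HB Require Import structures.
From mathcomp Require Import all_boot all_order all_algebra.
From mathcomp Require Import complex generic_quotient.
From mathcomp Require Import all_classical all_reals topology normedtype sequences.
Import numFieldNormedType.Exports.

Set Implicit Arguments.
Unset Strict Implicit.
Unset Printing Implicit Defensive.

Import Order.TTheory GRing.Theory Num.Theory.
Local Open Scope classical_set_scope.
Local Open Scope ring_scope.
Local Open Scope quotient_scope.

(* As an [algType] has 1 != 0, the zero algebra is excluded. The norm is
   carried explicitly since the library has no join of [algType] with
   [normedModType]. *)
HB.mixin Record isCStarAlgebra (R : realType) A of GRing.Algebra R[i] A := {
  star : A -> A;
  cnorm : A -> R;
  star_semilinear : forall (a : R[i]) (x y : A),
    star (a *: x + y) = a^* *: star x + star y;
  starM : forall x y : A, star (x * y) = star y * star x;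
  starK : involutive star;
  cnorm0_eq0 : forall x : A, cnorm x = 0 -> x = 0;
  ler_cnormD : forall x y : A, cnorm (x + y) <= cnorm x + cnorm y;
  cnormZ : forall (a : R[i]) (x : A), cnorm (a *: x) = Normc.normc a * cnorm x;
  ler_cnormM : forall x y : A, cnorm (x * y) <= cnorm x * cnorm y;
  cnorm_starM : forall x : A, cnorm (star x * x) = cnorm x ^+ 2;
  cnorm_complete : forall x_ : nat -> A,
    (forall e : R, 0 < e -> exists N : nat, forall m n : nat,
       (N <= m)%N -> (N <= n)%N -> cnorm (x_ m - x_ n) < e) ->
    exists l : A, cnorm (x_ n - l) @[n --> \oo] --> (0 : R)
}.

#[short(type="cstarAlgType")]
HB.structure Definition CStarAlgebra (R : realType) :=
  {A of isCStarAlgebra R A & GRing.Algebra R[i] A}.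

Section CStarTheory.
Context {R : realType}.
Implicit Types A B : cstarAlgType R.

Definition star_hom A B (f : A -> B) : Prop :=
  [/\ linear f, monoid_morphism f & {morph f : x / star x}].

Definition isometry_elt A (s : A) : Prop := star s * s = 1.

Definition unitary_elt A (w : A) : Prop := star w * w = 1 /\ w * star w = 1.

Definition norm_closed A (S : set A) : Prop :=
  forall (x_ : nat -> A) (l : A), (forall n, S (x_ n)) ->
    cnorm (x_ n - l) @[n --> \oo] --> (0 : R) -> S l.

Definition cstar_subalgebra A (S : set A) : Prop :=
  [/\ norm_closed S,
      S 0,
      forall (a : R[i]) x y, S x -> S y -> S (a *: x + y),
      forall x y, S x -> S y -> S (x * y) &
      forall x, S x -> S (star x)].

(* C*(S) *)
Definition cstar_generated A (S : set A) : set A :=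
  smallest (@cstar_subalgebra A) S.

Lemma star1 A : star (1 : A) = 1.
Proof. by have := starM (1 : A) (star 1); rewrite mul1r starK mul1r => <-. Qed.

End CStarTheory.

Section Aut.
Context {R : realType} (A : cstarAlgType R).

Record cstar_aut := CStarAut {
  cstar_aut_fun :> A -> A;
  cstar_aut_hom : star_hom cstar_aut_fun;
  cstar_aut_bij : bijective cstar_aut_fun
}.

HB.instance Definition _ := gen_eqMixin cstar_aut.
HB.instance Definition _ := gen_choiceMixin cstar_aut.

Lemma cstar_aut_ext (f g : cstar_aut) : f =1 g -> f = g.
Proof.
case: f g => [f hf bf] [g hg bg] /= /funext e; case: _ / e in hg bg *.
by congr CStarAut; exact: Prop_irrelevance.
Qed.

Lemma star_hom_id : star_hom (@id A).
Proof. by []. Qed.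

Lemma star_hom_comp (f g : A -> A) :
  star_hom f -> star_hom g -> star_hom (f \o g).
Proof.
move=> [fl [f1 fM] fs] [gl [g1 gM] gs]; split.
- by move=> a x y /=; rewrite gl fl.
- by split=> [|x y] /=; rewrite ?g1 ?f1 ?gM ?fM.
- by move=> x /=; rewrite gs fs.
Qed.

Lemma star_hom_can (f g : A -> A) :
  star_hom f -> cancel f g -> cancel g f -> star_hom g.
Proof.
move=> [fl [f1 fM] fs] fK gK; split.
- by move=> a x y; rewrite -{1}(gK x) -{1}(gK y) -fl fK.
- by split=> [|x y]; [rewrite -f1 fK|rewrite -{1}(gK x) -{1}(gK y) -fM fK].
- by move=> x; rewrite -{1}(gK x) -fs fK.
Qed.

Definition aut_one := CStarAut star_hom_id (Bijective (frefl id) (frefl id)).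

Definition aut_mul (f g : cstar_aut) : cstar_aut :=
  CStarAut (star_hom_comp (cstar_aut_hom f) (cstar_aut_hom g))
           (bij_comp (cstar_aut_bij f) (cstar_aut_bij g)).

Lemma aut_inv_subproof (f : cstar_aut) :
  exists g : cstar_aut, cancel f g /\ cancel g f.
Proof.
have [g fK gK] := cstar_aut_bij f.
by exists (CStarAut (star_hom_can (cstar_aut_hom f) fK gK) (Bijective gK fK)).
Qed.

Definition aut_inv (f : cstar_aut) : cstar_aut := xget f
  [set g : cstar_aut | cancel f g /\ cancel g f].

Lemma aut_invP (f : cstar_aut) : cancel f (aut_inv f) /\ cancel (aut_inv f) f.
Proof.
by have [g hg] := aut_inv_subproof f; rewrite /aut_inv; case: xgetP => [h _ []|/(_ g)].
Qed.

Lemma aut_mulA : associative aut_mul.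
Proof. by move=> f g h; apply: cstar_aut_ext. Qed.
Lemma aut_mul1g : left_id aut_one aut_mul.
Proof. by move=> f; apply: cstar_aut_ext. Qed.
Lemma aut_mulg1 : right_id aut_one aut_mul.
Proof. by move=> f; apply: cstar_aut_ext. Qed.
Lemma aut_mulVg : left_inverse aut_one aut_inv aut_mul.
Proof. by move=> f; apply: cstar_aut_ext => x /=; exact: (aut_invP f).1. Qed.
Lemma aut_mulgV : right_inverse aut_one aut_inv aut_mul.
Proof. by move=> f; apply: cstar_aut_ext => x /=; exact: (aut_invP f).2. Qed.

HB.instance Definition _ :=
  isGroup.Build cstar_aut aut_mulA aut_mul1g aut_mulg1 aut_mulVg aut_mulgV.

Definition inner_aut (f : cstar_aut) : Prop :=
  exists2 w : A, unitary_elt w & forall x, f x = w * x * star w.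

End Aut.

Section Out.
Context {R : realType} (A : cstarAlgType R).
Implicit Types f g h : cstar_aut A.

Lemma inner_aut1 : inner_aut (1 : cstar_aut A)%g.
Proof.
exists 1 => [|x]; first by split; rewrite star1 mulr1.
by rewrite star1 mulr1 mul1r.
Qed.

Lemma inner_autM f g : inner_aut f -> inner_aut g -> inner_aut (f * g)%g.
Proof.
move=> [v [v1 v2] fE] [w [w1 w2] gE]; exists (v * w) => [|x].
  split; rewrite starM.
    by rewrite mulrA -(mulrA (star w)) v1 mulr1.
  by rewrite mulrA -(mulrA v) w2 mulr1.
by rewrite /= gE fE starM !mulrA.
Qed.

Lemma inner_autV f : inner_aut f -> inner_aut f^-1%g.
Proof.
move=> [w [w1 w2] fE]; exists (star w) => [|x]; first by split; rewrite starK.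
have {1}-> : x = f (star w * x * w) by rewrite fE !mulrA w2 mul1r -mulrA w2 mulr1.
by rewrite starK; exact: (aut_invP f).1.
Qed.

Lemma inner_autJ f g : inner_aut f -> inner_aut (g * f * g^-1)%g.
Proof.
move=> [w [w1 w2] fE]; have [gl [g1 gM] gs] := cstar_aut_hom g.
exists (g w) => [|x]; first by split; rewrite -gs -gM ?w1 ?w2.
by rewrite /= fE !gM gs (aut_invP g).2.
Qed.

Definition out_rel f g : bool := `[< inner_aut (f * g^-1)%g >].

Lemma out_rel_refl : reflexive out_rel.
Proof. by move=> f; apply/asboolP; rewrite mulgV; exact: inner_aut1. Qed.

Lemma out_rel_sym : symmetric out_rel.
Proof.
by move=> f g; apply/asboolP/asboolP => /inner_autV; rewrite invgM invgK.
Qed.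

Lemma out_rel_trans : transitive out_rel.
Proof.
move=> g f h /asboolP fg /asboolP gh; apply/asboolP.
by move: (inner_autM fg gh); rewrite mulgA -(mulgA f) mulVg mulg1.
Qed.

Canonical out_equiv := EquivRel out_rel out_rel_refl out_rel_sym out_rel_trans.

Definition Out := {eq_quot out_rel}.
HB.instance Definition _ := Choice.on Out.
HB.instance Definition _ := EqQuotient.on Out.

Definition out_one : Out := \pi_Out 1%g.
Definition out_mul (a b : Out) : Out := \pi_Out (repr a * repr b)%g.
Definition out_inv (a : Out) : Out := \pi_Out (repr a)^-1%g.

Lemma out_eqP f g : \pi_Out f = \pi_Out g <-> inner_aut (f * g^-1)%g.
Proof. by split=> [/eqmodP/asboolP|?]; last by apply/eqmodP/asboolP. Qed.

Lemma out_piM f g : \pi_Out (f * g)%g = out_mul (\pi f) (\pi g).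
Proof.
apply/out_eqP.
have := reprK (\pi_Out f); have := reprK (\pi_Out g).
set f' := repr (\pi_Out f); set g' := repr (\pi_Out g).
move=> /esym/out_eqP Hg /esym/out_eqP Hf.
have -> : ((f * g) * (f' * g')^-1 = (f * (g * g'^-1) * f^-1) * (f * f'^-1))%g.
  by rewrite invgM !mulgA mulgVK.
by apply: inner_autM => //; exact: inner_autJ.
Qed.

Lemma out_piV f : \pi_Out f^-1%g = out_inv (\pi f).
Proof.
apply/out_eqP.
have /esym/out_eqP Hf := reprK (\pi_Out f).
set f' := repr (\pi_Out f) in Hf *.
have -> : (f^-1 * f'^-1^-1 = f^-1 * (f * f'^-1)^-1 * f^-1^-1)%g.
  by rewrite invgM !invgK -!mulgA mulVg mulg1.
by apply: inner_autJ; exact: inner_autV.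
Qed.

Lemma out_mulA : associative out_mul.
Proof.
move=> a b c; rewrite -[a]reprK -[b]reprK -[c]reprK.
by rewrite -!out_piM mulgA.
Qed.
Lemma out_mul1g : left_id out_one out_mul.
Proof. by move=> a; rewrite -[a]reprK -out_piM mul1g. Qed.
Lemma out_mulg1 : right_id out_one out_mul.
Proof. by move=> a; rewrite -[a]reprK -out_piM mulg1. Qed.
Lemma out_mulVg : left_inverse out_one out_inv out_mul.
Proof. by move=> a; rewrite -[a]reprK -out_piV -out_piM mulVg. Qed.
Lemma out_mulgV : right_inverse out_one out_inv out_mul.
Proof. by move=> a; rewrite -[a]reprK -out_piV -out_piM mulgV. Qed.

HB.instance Definition _ :=
  isGroup.Build Out out_mulA out_mul1g out_mulg1 out_mulVg out_mulgV.

Definition out_class (f : cstar_aut A) : Out := \pi_Out f.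

Definition aut_stabilizing (B : set A) : set (cstar_aut A) :=
  [set f | f @` B = B].

End Out.

Definition abelian_set (G : groupType) (S : set G) : Prop :=
  forall a b : G, S a -> S b -> (a * b = b * a)%g.

Section TwoAdicRingAlgebra.
Context {R : realType}.

Definition Q2_relations (A : cstarAlgType R) (u s2 : A) : Prop :=
  [/\ unitary_elt u,
      isometry_elt s2,
      s2 * u = u ^+ 2 * s2 &
      s2 * star s2 + u * s2 * star s2 * star u = 1].

Definition is_Q2 (Q : cstarAlgType R) (u s2 : Q) : Prop :=
  [/\ Q2_relations u s2,
      cstar_generated [set u; s2] = setT &
      forall (B : cstarAlgType R) (v t : B), Q2_relations v t ->
        exists! f : Q -> B, [/\ star_hom f, f u = v & f s2 = t]].

Definition O2 (Q : cstarAlgType R) (u s2 : Q) : set Q :=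
  cstar_generated [set u * s2; s2].

End TwoAdicRingAlgebra.

(* Main.v *)
Require Import Defs.
From mathcomp Require Import all_boot all_order all_algebra.
From mathcomp Require Import all_classical all_reals.
From mathcomp Require Import complex interval_inference topology normedtype.
From mathcomp Require Import sequences ring lra zify.
Import Order.TTheory GRing.Theory Num.Theory.
Import numFieldNormedType.Exports.

Set Implicit Arguments.
Unset Strict Implicit.
Unset Printing Implicit Defensive.

Local Open Scope classical_set_scope.
Local Open Scope ring_scope.

(* The diagonal algebra D of O_2 is the algebra of continuous functions on the
   2-adic integers, on which u and s_2 act as x |-> x + 1 and x |-> 2 x. If a
   unitary W = exp(i v) of D satisfies v(2x) + v(2x+1) = v(x), then u |-> u W,
   s_2 |-> s_2 defines an automorphism kappa of Q_2, which fixes D and preserves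
   O_2. A solution invariant under the flip x |-> -1 - x is
   v(x) = c \sum_k 2^-k (-1)^(x_k + x_(k+1)), where x_k are the binary digits of
   x; it is not locally constant, so W is built as an infinite product.

   Let F be the flip-flop automorphism u |-> u^*, s_2 |-> s_1. Flip invariance
   of v gives F kappa F = Ad(W^* ) kappa^-1, so if the classes of F and kappa
   commuted, kappa^2 would be inner, say kappa^2 = Ad(w). Then w commutes with
   s_2, so s_2^*n w s_2^n = w for all n; as these compressions bring any
   *-polynomial in u and s_2 eventually into the span of the powers of s_2 and
   s_2^*, the corner s_1^* w s_1 is a limit of scalars. This forces W to commute
   with s_2, which for c = pi / 2 is absurd. *)

(** * Norm, limits and contractivity of *-homomorphisms *)

Section CStarNorm.
Context {R : realType} {A : cstarAlgType R}.
Implicit Types (x y z : A) (a : R[i]).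

Lemma starD x y : star (x + y) = star x + star y.
Proof. by have := star_semilinear 1 x y; rewrite conjC1 !scale1r. Qed.

Lemma star0 : star (0 : A) = 0.
Proof.
by have /esym/eqP := starD 0 0; rewrite addr0 -subr_eq0 addrK => /eqP.
Qed.

Lemma starZ a x : star (a *: x) = a^* *: star x.
Proof. by rewrite -[a *: x]addr0 star_semilinear star0 addr0. Qed.

Lemma starN x : star (- x) = - star x.
Proof. by apply/eqP; rewrite -addr_eq0 -starD addNr star0. Qed.

Lemma starB x y : star (x - y) = star x - star y.
Proof. by rewrite starD starN. Qed.

Lemma cnorm0 : cnorm (0 : A) = 0.
Proof. by rewrite -(scale0r (0 : A)) cnormZ Normc.normc0 mul0r. Qed.

Lemma normcN1 : Normc.normc (-1 : R[i]) = 1.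
Proof. by rewrite -(Normc.normc1 R) (normcN (1 : Rcomplex R)). Qed.

Lemma cnormN x : cnorm (- x) = cnorm x.
Proof. by rewrite -scaleN1r cnormZ normcN1 mul1r. Qed.

Lemma cnormB x y : cnorm (x - y) = cnorm (y - x).
Proof. by rewrite -cnormN opprB. Qed.

Lemma cnorm_ge0 x : 0 <= cnorm x.
Proof.
have := ler_cnormD x (- x); rewrite subrr cnorm0 cnormN -mulr2n.
by rewrite pmulrn_lge0.
Qed.

(** The C*-identity gives [cnorm y ^+ 2 <= cnorm (star y) * cnorm y]; cancelling [cnorm y], for
    [y = x] and [y = star x], gives both inequalities. *)
Lemma cnorm_star x : cnorm (star x) = cnorm x.
Proof.
suff le_star y : cnorm y <= cnorm (star y).
  by apply/eqP; rewrite eq_le le_star -{2}(starK x) le_star.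
have := ler_cnormM (star y) y; rewrite cnorm_starM expr2.
have [->|/eqP y0] := eqVneq (cnorm y) 0; first by rewrite cnorm_ge0.
by rewrite ler_pM2r // lt_def cnorm_ge0 andbT; apply/eqP.
Qed.

Lemma cnorm_isometry x : isometry_elt x -> cnorm x = 1.
Proof.
(* The C*-identity makes [cnorm 1] equal to its own square, and the value 0 would force [1 = 0]. *)
have n1 : cnorm (1 : A) = 1.
  have := cnorm_starM (1 : A); rewrite star1 mulr1 expr2 => /eqP.
  rewrite -subr_eq0 -{1}[cnorm 1]mulr1 -mulrBr mulf_eq0 => /orP[/eqP/cnorm0_eq0
    h|].
    by have := oner_neq0 A; rewrite h eqxx.
  by rewrite subr_eq0 => /eqP <-.
move=> hx; have := cnorm_starM x; rewrite hx n1 => /esym/eqP.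
by rewrite sqrf_eq1 => /orP[/eqP//|/eqP h]; have := cnorm_ge0 x; rewrite h; lra.
Qed.

Lemma cnorm1 : cnorm (1 : A) = 1.
Proof. by apply: cnorm_isometry; rewrite /isometry_elt star1 mulr1. Qed.

Lemma cnorm_mulr_le x y : cnorm y <= 1 -> cnorm (x * y) <= cnorm x.
Proof.
by move=> y1; apply: le_trans (ler_cnormM _ _) _; rewrite ler_piMr // cnorm_ge0.
Qed.

Lemma cnorm_mull_le x y : cnorm x <= 1 -> cnorm (x * y) <= cnorm y.
Proof.
by move=> y1; apply: le_trans (ler_cnormM _ _) _; rewrite ler_piMl // cnorm_ge0.
Qed.

Lemma normcR (r : R) : Normc.normc (r%:C)%C = `|r|.
Proof. by rewrite /Normc.normc /= expr0n /= addr0 sqrtr_sqr. Qed.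

Lemma cnorm_half x : cnorm ((2^-1%:C)%C *: x) = cnorm x / 2.
Proof. by rewrite cnormZ normcR ger0_norm ?invr_ge0 // mulrC. Qed.

(** An epsilon form of norm convergence, equivalent by [cnorm_cvgP] to the filter form in
    [norm_closed]; limits are handled through it from here on. *)
Definition cnorm_cvg (x_ : nat -> A) (l : A) : Prop :=
  forall e : R, 0 < e -> exists N : nat, forall n : nat,
    (N <= n)%N -> cnorm (x_ n - l) < e.

Lemma cnorm_cvgP (x_ : nat -> A) (l : A) :
  cnorm (x_ n - l) @[n --> \oo] --> (0 : R) <-> cnorm_cvg x_ l.
Proof.
split=> [/cvgr0Pnorm_lt h e e0|h].
  have [N _ hN] := h e e0; exists N => n /hN /=.
  by rewrite ger0_norm // cnorm_ge0.
apply/cvgr0Pnorm_lt => e /h[N hN]; exists N => // n /hN /=.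
by rewrite ger0_norm // cnorm_ge0.
Qed.

Lemma cnorm_le_eq0 x : (forall e : R, 0 < e -> cnorm x <= e) -> x = 0.
Proof.
move=> h; apply: cnorm0_eq0; apply/eqP; rewrite eq_le cnorm_ge0 andbT.
by apply/ler_addgt0Pr => e /h; rewrite add0r.
Qed.

Lemma cnorm_cvg_unique (x_ : nat -> A) l l' :
  cnorm_cvg x_ l -> cnorm_cvg x_ l' -> l = l'.
Proof.
move=> hl hl'; apply/eqP; rewrite -subr_eq0; apply/eqP; apply: cnorm_le_eq0.
move=> e e0; have e20 : 0 < e / 2 by lra.
have [N hN] := hl _ e20; have [N' hN'] := hl' _ e20.
have h := hN _ (leq_maxl N N'); have h' := hN' _ (leq_maxr N N').
have -> : l - l' = (l - x_ (maxn N N')) + (x_ (maxn N N') - l').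
  by rewrite addrA subrK.
by apply: le_trans (ler_cnormD _ _) _; rewrite cnormB; lra.
Qed.

Lemma cnorm_cvg_cst x : cnorm_cvg (fun=> x) x.
Proof. by move=> e e0; exists 0%N => n _; rewrite subrr cnorm0. Qed.

Lemma eq_cnorm_cvg (x_ y_ : nat -> A) l :
  x_ =1 y_ -> cnorm_cvg x_ l -> cnorm_cvg y_ l.
Proof. by move=> /funext ->. Qed.

Lemma cnorm_cvgS (x_ : nat -> A) l :
  cnorm_cvg x_ l -> cnorm_cvg (fun n => x_ n.+1) l.
Proof. by move=> h e /h[N hN]; exists N => n Nn; apply: hN; rewrite leqW. Qed.

End CStarNorm.

(** A Lipschitz estimate between two possibly different algebras, so that it serves for products,
    scalars, [star] and *-homomorphisms alike. Dividing by [1 + |K|] spares any assumption on the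
    sign of [K]. *)
Lemma cnorm_cvg_bounded (R : realType) (A B : cstarAlgType R) (K : R)
    (x_ : nat -> A) (y_ : nat -> B) l m :
  (forall n, cnorm (y_ n - m) <= K * cnorm (x_ n - l)) ->
  cnorm_cvg x_ l -> cnorm_cvg y_ m.
Proof.
move=> h hx e e0; have K1 : 0 < 1 + `|K| by apply: ltr_wpDr.
have [N hN] := hx (e / (1 + `|K|)) (divr_gt0 e0 K1).
exists N => n /hN; rewrite ltr_pdivlMr // => hn.
apply: le_lt_trans (h n) _; apply: le_lt_trans hn.
rewrite mulrC ler_wpM2l ?cnorm_ge0 // (le_trans (ler_norm K)) //.
by rewrite lerDr.
Qed.

Section CStarLimit.
Context {R : realType} {A : cstarAlgType R}.
Implicit Types (x y z : A) (a : R[i]).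

Lemma cnorm_cvgD (x_ y_ : nat -> A) l m :
  cnorm_cvg x_ l -> cnorm_cvg y_ m -> cnorm_cvg (fun n => x_ n + y_ n) (l + m).
Proof.
move=> hx hy e e0; have e20 : 0 < e / 2 by lra.
have [N hN] := hx _ e20; have [N' hN'] := hy _ e20.
exists (maxn N N') => n; rewrite geq_max => /andP[/hN h /hN' h'].
by rewrite opprD addrACA; apply: le_lt_trans (ler_cnormD _ _) _; lra.
Qed.

Lemma cnorm_cvgMl x (x_ : nat -> A) l :
  cnorm_cvg x_ l -> cnorm_cvg (fun n => x * x_ n) (x * l).
Proof.
by apply: (@cnorm_cvg_bounded _ _ _ (cnorm x)) => n; rewrite -mulrBr ler_cnormM.
Qed.

Lemma cnorm_cvgMr x (x_ : nat -> A) l :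
  cnorm_cvg x_ l -> cnorm_cvg (fun n => x_ n * x) (l * x).
Proof.
apply: (@cnorm_cvg_bounded _ _ _ (cnorm x)) => n.
by rewrite -mulrBl mulrC ler_cnormM.
Qed.

Lemma cnorm_cvgZ a (x_ : nat -> A) l :
  cnorm_cvg x_ l -> cnorm_cvg (fun n => a *: x_ n) (a *: l).
Proof.
apply: (@cnorm_cvg_bounded _ _ _ (Normc.normc a)) => n.
by rewrite -scalerBr cnormZ.
Qed.

Lemma cnorm_cvg_star (x_ : nat -> A) l :
  cnorm_cvg x_ l -> cnorm_cvg (fun n => star (x_ n)) (star l).
Proof.
by apply: (@cnorm_cvg_bounded _ _ _ 1) => n; rewrite -starB cnorm_star mul1r.
Qed.

Lemma cnorm_cvgM (x_ y_ : nat -> A) l m :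
  cnorm_cvg x_ l -> cnorm_cvg y_ m -> cnorm_cvg (fun n => x_ n * y_ n) (l * m).
Proof.
(* The product is split as [(x_ n - l) * (y_ n - m) + l * (y_ n - m) + x_ n * m]. *)
move=> hx hy.
have h0 : cnorm_cvg (fun n => (x_ n - l) * (y_ n - m)) 0.
  move=> e e0; have [N hN] := hx _ e0; have [N' hN'] := hy _ ltr01.
  exists (maxn N N') => n; rewrite geq_max => /andP[/hN hx0 /hN' /ltW hy1].
  by rewrite subr0; apply: le_lt_trans hx0; apply: cnorm_mulr_le.
have hl : cnorm_cvg (fun n => l * (y_ n - m)) 0.
  apply: (@cnorm_cvg_bounded _ _ _ (cnorm l)) hy => n.
  by rewrite subr0 ler_cnormM.
have := cnorm_cvgD (cnorm_cvgD h0 hl) (cnorm_cvgMr m hx).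
rewrite !add0r; apply: eq_cnorm_cvg => n.
by rewrite -mulrDl subrK mulrBr subrK.
Qed.

Lemma cnorm_geometric_cvg (x_ : nat -> A) (K q : R) :
  0 <= q < 1 -> (forall n, cnorm (x_ n.+1 - x_ n) <= K * q ^+ n) ->
  exists l, cnorm_cvg x_ l.
Proof.
move=> /andP[q0 q1] hx; have q1' : 0 < 1 - q by lra.
have K0 : 0 <= K by have := le_trans (cnorm_ge0 _) (hx 0%N); rewrite mulr1.
have tail m k : cnorm (x_ (m + k)%N - x_ m) <= K * q ^+ m / (1 - q).
  (* The exact partial sum of the geometric series is the bound that passes through the induction on
     [k]. *)
  suff : cnorm (x_ (m + k)%N - x_ m) <= K * q ^+ m * (1 - q ^+ k) / (1 - q).
    move/le_trans; apply; rewrite ler_wpM2r ?invr_ge0 ?(ltW q1') //.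
    rewrite ler_piMr ?mulr_ge0 ?exprn_ge0 //.
    by rewrite lerBlDr lerDl exprn_ge0.
  elim: k => [|k ih]; first by rewrite addn0 subrr cnorm0 expr0 subrr mulr0
    mul0r.
  have -> : x_ (m + k.+1)%N - x_ m =
    (x_ (m + k).+1 - x_ (m + k)%N) + (x_ (m + k)%N - x_ m).
    by rewrite addnS addrA subrK.
  apply: le_trans (ler_cnormD _ _) _.
  apply: le_trans (lerD (hx _) ih) _.
  have -> : K * q ^+ m * (1 - q ^+ k.+1) / (1 - q) =
    K * q ^+ (m + k) + K * q ^+ m * (1 - q ^+ k) / (1 - q).
    by rewrite exprD exprS; field; lra.
  exact: lexx.
have small e : 0 < e -> exists N, forall m, (N <= m)%N -> K * q ^+ m / (1 - q)
  < e.
  move=> e0.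
  have /cvgr0Pnorm_lt : q ^+ n @[n --> \oo] --> (0 : R).
    by apply: cvg_expr; rewrite ger0_norm.
  have d0 : 0 < e * (1 - q) / (1 + K) by apply: divr_gt0; [exact: mulr_gt0|lra].
  move=> /(_ _ d0) [N _ hN]; exists N => m /hN /=.
  rewrite ger0_norm ?exprn_ge0 // ltr_pdivlMr; last lra.
  move=> h.
  rewrite ltr_pdivrMr //; apply: le_lt_trans h.
  by rewrite mulrC ler_wpM2l ?exprn_ge0 // lerDr.
have [l hl] : exists l, cnorm (x_ n - l) @[n --> \oo] --> (0 : R).
  apply: cnorm_complete => e e0.
  have e20 : 0 < e / 2 by lra.
  have [N hN] := small _ e20; exists N => m n Nm Nn.
  have h i : (N <= i)%N -> cnorm (x_ i - x_ N) < e / 2.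
    by move=> Ni; rewrite -(subnKC Ni); apply: le_lt_trans (tail _ _) (hN _ _).
  have -> : x_ m - x_ n = (x_ m - x_ N) + (x_ N - x_ n) by rewrite addrA subrK.
  apply: le_lt_trans (ler_cnormD _ _) _; rewrite (cnormB (x_ N)).
  by have := h _ Nm; have := h _ Nn; lra.
by exists l; apply/cnorm_cvgP.
Qed.

(* [y = 1 - sqrt (1 - b)] is the fixed point of [y |-> (b + y^2) / 2], which
   contracts the ball of radius [cnorm b]. *)
Lemma sqrt_oneB (b : A) : star b = b -> cnorm b < 1 ->
  exists y, [/\ star y = y, (1 - y) * (1 - y) = 1 - b &
    forall x, x * b = b * x -> x * y = y * x].
Proof.
move=> sb b1; pose h : R[i] := (2^-1%:C)%C.
have hh x : h *: x + h *: x = x.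
  suff hh1 : h + h = 1 by rewrite -scalerDl hh1 scale1r.
  apply/eqP; rewrite eq_complex /=; apply/andP; split; apply/eqP; lra.
have ch : h^* = h by exact: conjc_real.
pose y_ := fix y_ n := if n is m.+1 then h *: (b + y_ m * y_ m) else 0 : A.
have yb n : cnorm (y_ n) <= cnorm b.
  elim: n => [|n ih] /=; first by rewrite cnorm0 cnorm_ge0.
  rewrite cnorm_half ler_pdivrMr // mulr_natr mulr2n.
  apply: le_trans (ler_cnormD _ _) _; rewrite lerD2l.
  exact: le_trans (cnorm_mulr_le _ (le_trans ih (ltW b1))) ih.
have dy n : cnorm (y_ n.+1 - y_ n) <= 1 * cnorm b ^+ n.
  elim: n => [|n ih].
    rewrite mul1r expr0 /= mulr0 addr0 subr0 cnorm_half.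
    by have := cnorm_ge0 b; lra.
  rewrite [y_ n.+2]/= [X in _ - X]/= -scalerBr opprD addrACA subrr add0r.
  have -> : h *: (b + y_ n * y_ n) = y_ n.+1 by [].
  rewrite cnorm_half ler_pdivrMr // mulr_natr mulr2n.
  (* This splitting of a difference of squares needs no commutation; both factors [y_] are bounded
     by [cnorm b]. *)
  have -> : y_ n.+1 * y_ n.+1 - y_ n * y_ n =
    y_ n.+1 * (y_ n.+1 - y_ n) + (y_ n.+1 - y_ n) * y_ n.
    by rewrite mulrBr mulrBl addrA subrK.
  apply: le_trans (ler_cnormD _ _) _.
  apply: lerD; apply: le_trans (ler_cnormM _ _) _; rewrite mul1r in ih;
    rewrite mul1r.
    by rewrite exprS ler_pM ?cnorm_ge0 ?yb.
  by rewrite exprSr ler_pM ?cnorm_ge0 ?yb.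
have [|y hy] := cnorm_geometric_cvg _ dy; first by rewrite cnorm_ge0.
have fy : y = h *: (b + y * y).
  apply: cnorm_cvg_unique (cnorm_cvgS hy) _.
  exact: cnorm_cvgZ (cnorm_cvgD (cnorm_cvg_cst b) (cnorm_cvgM hy hy)).
exists y; split.
- apply: (cnorm_cvg_unique (cnorm_cvg_star hy)).
  apply: eq_cnorm_cvg hy => n; elim: n => [|n ih] /=; first by rewrite star0.
  by rewrite starZ starD starM sb -ih ch.
- have e : y + y = b + y * y by rewrite {1 2}fy hh.
  rewrite mulrBr mulr1 mulrBl mul1r opprB [y * y - y]addrC addrA.
  by rewrite -[1 - y - y]addrA -opprD e opprD addrA subrK.
- move=> x xb; apply: (cnorm_cvg_unique (cnorm_cvgMl x hy)).
  apply: eq_cnorm_cvg (cnorm_cvgMr x hy) => n.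
  elim: n => [|n ih] /=; first by rewrite mulr0 mul0r.
  by rewrite -scalerAl -scalerAr mulrDl mulrDr xb -mulrA ih !mulrA ih.
Qed.

End CStarLimit.

Section StarHom.
Context {R : realType}.
Implicit Types A B : cstarAlgType R.

Lemma star_homM A B (f : A -> B) (hf : star_hom f) x y : f (x * y) = f x * f y.
Proof. by case: hf => _ [_ fM] _. Qed.

Lemma star_homS A B (f : A -> B) (hf : star_hom f) x : f (star x) = star (f x).
Proof. by case: hf. Qed.

Lemma star_hom1 A B (f : A -> B) (hf : star_hom f) : f 1 = 1.
Proof. by case: hf => _ [f1 _] _. Qed.

Lemma star_hom0 A B (f : A -> B) (hf : star_hom f) : f 0 = 0.
Proof.
have [fl _ _] := hf; have := fl (- 1) 0 0.
by rewrite !scaleN1r oppr0 addr0 addNr.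
Qed.

Lemma star_homD A B (f : A -> B) (hf : star_hom f) x y : f (x + y) = f x + f y.
Proof. by have [fl _ _] := hf; have := fl 1 x y; rewrite !scale1r. Qed.

Lemma star_homZ A B (f : A -> B) (hf : star_hom f) a x : f (a *: x) = a *: f x.
Proof.
by have [fl _ _] := hf; rewrite -[a *: x]addr0 fl (star_hom0 hf) addr0.
Qed.

Lemma star_homN A B (f : A -> B) (hf : star_hom f) x : f (- x) = - f x.
Proof. by rewrite -scaleN1r (star_homZ hf) scaleN1r. Qed.

Lemma star_homB A B (f : A -> B) (hf : star_hom f) x y : f (x - y) = f x - f y.
Proof. by rewrite (star_homD hf) (star_homN hf). Qed.

(* [a] is the real part of the unitary [a + 'i sqrt (1 - a^2)]. *)
Lemma cnorm_star_hom_selfadjoint A B (f : A -> B) a :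
  star_hom f -> star a = a -> cnorm a < 1 -> cnorm (f a) <= 1.
Proof.
move=> hf sa a1.
have [||y [sy ysq yC]] := @sqrt_oneB R A (a * a).
- by rewrite starM sa.
- by apply: le_lt_trans (cnorm_mulr_le _ (ltW a1)) a1.
pose w := a + 'i *: (1 - y).
have sw : star w = a - 'i *: (1 - y).
  by rewrite /w starD starZ conjCi scaleNr starB star1 sa sy.
have ay : a * (1 - y) = (1 - y) * a.
  by rewrite mulrBr mulrBl mulr1 mul1r yC // mulrA.
have w1 : star w * w = 1.
  rewrite sw /w mulrDr !mulrBl -!scalerAl -!scalerAr ay ysq scalerA -[_ *
    'i]expr2.
  by rewrite sqrCi scaleN1r opprK addrA subrK addrC subrK.
have fw : cnorm (f w) <= 1.
  by rewrite cnorm_isometry // /isometry_elt -(star_homS hf) -(star_homM hf) w1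
    (star_hom1 hf).
(* Since [f w] is an isometry and [star] is isometric, the triangle inequality bounds [2 f a] by
   2. *)
have a2 : a + a = w + star w by rewrite sw /w addrACA subrr addr0.
have : cnorm (f a + f a) <= 1 + 1.
  rewrite -(star_homD hf) a2 (star_homD hf) (star_homS hf).
  by apply: le_trans (ler_cnormD _ _) _; rewrite cnorm_star lerD.
have -> : f a + f a = (2%:R : R[i]) *: f a by rewrite scaler_nat mulr2n.
have n2 : Normc.normc (2%:R : R[i]) = 2.
  have -> : (2%:R : R[i]) = (2%:R%:C)%C by rewrite rmorph_nat.
  by rewrite normcR ger0_norm.
by rewrite cnormZ n2; lra.
Qed.

(** The C*-identity reduces to the self-adjoint [star x * x]; a self-adjoint [a] is rescaled by
    [(cnorm a + e)^-1] into the open unit ball, and [e] tends to 0. *)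
Lemma cnorm_star_hom A B (f : A -> B) x : star_hom f -> cnorm (f x) <= cnorm x.
Proof.
move=> hf.
suff selfadj a : star a = a -> cnorm (f a) <= cnorm a.
  rewrite -ler_sqr ?nnegrE ?cnorm_ge0 // -!cnorm_starM -(star_homS hf)
    -(star_homM hf).
  by apply: selfadj; rewrite starM starK.
move=> sa; apply/ler_addgt0Pr => e e0.
have t0 : 0 < cnorm a + e by apply: ltr_wpDl; rewrite ?cnorm_ge0.
pose r : R[i] := ((cnorm a + e)^-1%:C)%C.
have nr : Normc.normc r = (cnorm a + e)^-1.
  by rewrite normcR ger0_norm // invr_ge0 ltW.
have := @cnorm_star_hom_selfadjoint _ _ f (r *: a) hf.
rewrite starZ sa (_ : r^* = r); last exact: conjc_real.
rewrite (star_homZ hf) !cnormZ nr mulrC ltr_pdivrMr // mul1r ltrDl mulrC.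
by rewrite ler_pdivrMr // mul1r; apply.
Qed.

Lemma star_hom_cvg A B (f : A -> B) (x_ : nat -> A) l :
  star_hom f -> cnorm_cvg x_ l -> cnorm_cvg (fun n => f (x_ n)) (f l).
Proof.
move=> hf; apply: (@cnorm_cvg_bounded _ _ _ 1) => n.
by rewrite -(star_homB hf) mul1r cnorm_star_hom.
Qed.

End StarHom.

(** * C*-subalgebras *)

Section Subalgebra.
Context {R : realType}.
Implicit Types A B : cstarAlgType R.

Lemma norm_closedP A (S : set A) :
  norm_closed S <->
  forall (x_ : nat -> A) l, (forall n, S (x_ n)) -> cnorm_cvg x_ l -> S l.
Proof.
by split=> h x_ l hx /cnorm_cvgP; apply: h.
Qed.

Lemma cstar_subalgebraD A (S : set A) x y :
  cstar_subalgebra S -> S x -> S y -> S (x + y).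
Proof. by move=> [_ _ h _ _] Sx Sy; rewrite -[x]scale1r; apply: h. Qed.

Lemma cstar_subalgebraZ A (S : set A) a x :
  cstar_subalgebra S -> S x -> S (a *: x).
Proof. by move=> [_ S0 h _ _] Sx; rewrite -[_ *: x]addr0; apply: h. Qed.

Lemma cstar_subalgebraB A (S : set A) x y :
  cstar_subalgebra S -> S x -> S y -> S (x - y).
Proof.
move=> hS Sx Sy; apply: cstar_subalgebraD => //.
by rewrite -scaleN1r; apply: cstar_subalgebraZ.
Qed.

Lemma cstar_subalgebraM A (S : set A) x y :
  cstar_subalgebra S -> S x -> S y -> S (x * y).
Proof. by move=> [_ _ _ h _]; apply: h. Qed.

Lemma cstar_subalgebra_star A (S : set A) x :
  cstar_subalgebra S -> S x -> S (star x).
Proof. by move=> [_ _ _ _ h]; apply: h. Qed.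

Lemma cstar_subalgebra_cvg A (S : set A) (x_ : nat -> A) l :
  cstar_subalgebra S -> (forall n, S (x_ n)) -> cnorm_cvg x_ l -> S l.
Proof. by move=> [/norm_closedP h _ _ _ _]; apply: h. Qed.

Lemma cstar_generated_subalgebra A (S : set A) :
  cstar_subalgebra (cstar_generated S).
Proof.
split=> [||a x y hx hy|x y hx hy|x hx].
- apply/norm_closedP => x_ l hx hl T [hT ST].
  by apply: (cstar_subalgebra_cvg hT) hl => n; exact: hx.
- by move=> T [[_ T0 _ _ _] _].
- by move=> T hT; case: (hT) => -[_ _ h _ _] _; apply: h; [exact: hx|exact: hy].
- by move=> T hT; case: (hT) => -[_ _ _ h _] _; apply: h; [exact: hx|exact: hy].
- by move=> T hT; case: (hT) => -[_ _ _ _ h] _; apply: h; exact: hx.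
Qed.

Lemma sub_cstar_generated A (S : set A) : S `<=` cstar_generated S.
Proof. exact: sub_smallest. Qed.

Lemma cstar_generated_min A (S T : set A) :
  cstar_subalgebra T -> S `<=` T -> cstar_generated S `<=` T.
Proof. by move=> hT ST x; apply. Qed.

Lemma cstar_subalgebra_preimage A B (f : A -> B) (T : set B) :
  star_hom f -> cstar_subalgebra T -> cstar_subalgebra (f @^-1` T).
Proof.
move=> hf hT; split=> [||a x y Tx Ty|x y|x] /=.
- apply/norm_closedP => x_ l hx /(star_hom_cvg hf).
  exact: cstar_subalgebra_cvg hT hx.
- by rewrite /= (star_hom0 hf); case: hT.
- by rewrite (star_homD hf) (star_homZ hf); case: hT => _ _ h _ _; exact: h.
- by rewrite (star_homM hf); apply: cstar_subalgebraM.
- by rewrite (star_homS hf); apply: cstar_subalgebra_star.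
Qed.

Lemma cstar_subalgebra_equalizer A B (f g : A -> B) :
  star_hom f -> star_hom g -> cstar_subalgebra [set x | f x = g x].
Proof.
move=> hf hg; split=> [||a x y fx fy|x y fx fy|x fx] /=.
- apply/norm_closedP => x_ l hx hl; have hfl := star_hom_cvg hf hl.
  apply: (cnorm_cvg_unique hfl); apply: eq_cnorm_cvg (star_hom_cvg hg hl) => n.
  exact: esym (hx n).
- by rewrite (star_hom0 hf) (star_hom0 hg).
- by rewrite (star_homD hf) (star_homD hg) (star_homZ hf) (star_homZ hg) fx fy.
- by rewrite (star_homM hf) (star_homM hg) fx fy.
- by rewrite (star_homS hf) (star_homS hg) fx.
Qed.

Lemma cstar_subalgebra_commutant A (S : set A) :
  (forall y, S y -> S (star y)) ->
  cstar_subalgebra [set x | forall y, S y -> x * y = y * x].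
Proof.
move=> Sstar; split=> [|y|a x z hx hz y Sy|x z hx hz y Sy|x hx y Sy] /=.
- apply/norm_closedP => x_ l hx hl y Sy.
  apply: (cnorm_cvg_unique (cnorm_cvgMr y hl)).
  by apply: eq_cnorm_cvg (cnorm_cvgMl y hl) => n; rewrite hx.
- by rewrite mul0r mulr0.
- by rewrite mulrDl mulrDr -scalerAl -scalerAr hx // hz.
- by rewrite -mulrA hz // !mulrA hx.
- by apply: (can_inj starK); rewrite !starM starK hx //; apply: Sstar.
Qed.

(** Commutants of star-closed sets are C*-subalgebras. The commutant of [S] therefore contains the
    algebra generated by [S], and then so does the commutant of that algebra. *)
Lemma cstar_generated_comm A (S : set A) :
  (forall y, S y -> S (star y)) ->
  (forall x y, S x -> S y -> x * y = y * x) ->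
  forall x y, cstar_generated S x -> cstar_generated S y -> x * y = y * x.
Proof.
move=> Sstar SC x y Gx; move: y.
suff : cstar_generated S `<=` [set y | forall x, cstar_generated S x -> y * x =
  x * y].
  by move=> h y /h ->.
apply: cstar_generated_min.
  by apply: cstar_subalgebra_commutant => z; apply: cstar_subalgebra_star;
     exact: cstar_generated_subalgebra.
move=> y Sy z /= Gz.
have : cstar_generated S `<=` [set z | forall y, S y -> z * y = y * z].
  by apply: cstar_generated_min => [|u Su v Sv];
    [exact: cstar_subalgebra_commutant|exact: SC].
by move=> /(_ _ Gz) /(_ _ Sy) ->.
Qed.

(** Approximation to within every [e] is the same as being a limit of a sequence in [P] (errors
    [1 / (n + 1)]), and the operations are continuous along sequences. *)
Lemma cstar_subalgebra_closure A (P : set A) :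
  P 0 -> (forall a x y, P x -> P y -> P (a *: x + y)) ->
  (forall x y, P x -> P y -> P (x * y)) -> (forall x, P x -> P (star x)) ->
  cstar_subalgebra
    [set x | forall e : R, 0 < e -> exists2 y, P y & cnorm (x - y) < e].
Proof.
move=> P0 Pl PM Ps.
have seqP x : (forall e : R, 0 < e -> exists2 y, P y & cnorm (x - y) < e) <->
    exists2 y_ : nat -> A, (forall n, P (y_ n)) & cnorm_cvg y_ x.
  split=> [h|[y_ Py hy] e /hy[N hN]]; last first.
    by exists (y_ N) => //; rewrite cnormB; apply: hN.
  have h' n : exists2 y, P y & cnorm (x - y) < n.+1%:R^-1.
    by apply: h; rewrite invr_gt0.
  pose y_ n := sval (cid2 (h' n)).
  exists y_ => [n|e e0]; first by rewrite /y_; case: cid2.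
  have [N _ hN] := near_infty_natSinv_lt (PosNum e0).
  exists N => n /hN /= hn; rewrite cnormB; apply: lt_trans hn.
  by rewrite /y_; case: cid2.
split=> [||a x y|x y|x] /=.
- apply/norm_closedP => x_ l hx hl e e0.
  have e20 : 0 < e / 2 by lra.
  have [N hN] := hl _ e20; have [y Py hy] := hx N _ e20.
  exists y => //; rewrite -(subrK (x_ N) l) -addrA.
  apply: le_lt_trans (ler_cnormD _ _) _.
  by have := hN _ (leqnn N); rewrite cnormB; lra.
- by move=> e e0; exists 0; rewrite // subrr cnorm0.
- move=> /seqP[x_ Px hx] /seqP[y_ Py hy]; apply/seqP.
  exists (fun n => a *: x_ n + y_ n) => [n|]; first exact: Pl.
  exact: cnorm_cvgD (cnorm_cvgZ a hx) hy.
- move=> /seqP[x_ Px hx] /seqP[y_ Py hy]; apply/seqP.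
  by exists (fun n => x_ n * y_ n) => [n|]; [exact: PM|exact: cnorm_cvgM].
- move=> /seqP[x_ Px hx]; apply/seqP.
  by exists (fun n => star (x_ n)) => [n|]; [exact: Ps|exact: cnorm_cvg_star].
Qed.

End Subalgebra.

(** * The diagonal of a Cuntz algebra and the twisting unitary *)

Definition cuntz_pair (R : realType) (A : cstarAlgType R) (s1 s2 : A) : Prop :=
  [/\ isometry_elt s1, isometry_elt s2 & s1 * star s1 + s2 * star s2 = 1].

Section CuntzPair.
Context {R : realType} {A : cstarAlgType R} (s1 s2 : A).
Implicit Types (x y : A) (z w : R[i]).

(** On functions of a 2-adic integer this is composition with the shift that drops the lowest binary
    digit. *)
Definition canonical_endo x : A := s1 * x * star s1 + s2 * x * star s2.

Definition phase z : A := z *: (s2 * star s2) + z^* *: (s1 * star s1).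

(* In terms of the first two binary digits, [phase z] is the function
   [z ^ ((-1) ^ x0)] and [phase2 z] is [z ^ ((-1) ^ (x0 + x1))]. *)
Definition phase2 z : A := s2 * phase z * star s2 + s1 * phase z^* * star s1.

(** The [k]-th generating projection is the indicator function of the set where the digit [x_k] is
    0. *)
Definition diag_subalg : set A :=
  cstar_generated
    (1 |` range (fun k => iter k canonical_endo (s2 * star s2))).

(** As a function of the digits this is the product over [k < n] of
    [z_k ^ ((-1) ^ (x_k + x_(k+1)))]. *)
Fixpoint phase_prod (z : nat -> R[i]) n : A :=
  if n is m.+1 then phase_prod z m * iter m canonical_endo (phase2 (z m)) else
    1.

Hypothesis s12 : cuntz_pair s1 s2.
Local Notation theta := canonical_endo.

Let s11 : star s1 * s1 = 1. Proof. by case: s12. Qed.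
Let s22 : star s2 * s2 = 1. Proof. by case: s12. Qed.
Let sum1 : s1 * star s1 + s2 * star s2 = 1. Proof. by case: s12. Qed.

(** Compressing the range relation by [s1] leaves [star s1 * s2 * star s2 * s1 = 0], the square of
    [star s2 * s1] in the sense of the C*-identity. *)
Lemma cuntz_orthol : star s2 * s1 = 0.
Proof.
have : star s1 * (s1 * star s1 + s2 * star s2) * s1 = 1 by rewrite sum1 mulr1.
rewrite mulrDr mulrDl !mulrA s11 mul1r s11 => /eqP.
rewrite -subr_eq0 addrAC subrr add0r => /eqP h; apply: cnorm0_eq0.
apply/eqP; rewrite -sqrf_eq0 -cnorm_starM starM starK mulrA h cnorm0; exact/eqP.
Qed.
Let s21 := cuntz_orthol.

Lemma cuntz_orthor : star s1 * s2 = 0.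
Proof. by apply: (can_inj starK); rewrite starM starK s21 star0. Qed.
Let s1s2 := cuntz_orthor.

(** The two ranges sum to 1, so identities can be checked separately on each value of the lowest
    digit. *)
Lemma eq_cuntz x y : x * s1 = y * s1 -> x * s2 = y * s2 -> x = y.
Proof.
by move=> e1 e2; rewrite -[x]mulr1 -[y]mulr1 -sum1 !mulrDr !mulrA e1 e2.
Qed.

Lemma cuntz_proj1 : s1 * star s1 = 1 - s2 * star s2.
Proof. by rewrite -sum1 addrK. Qed.

Lemma canonical_endo_mul1 x : theta x * s1 = s1 * x.
Proof. by rewrite mulrDl -!mulrA s11 s21 !mulr0 addr0 mulr1. Qed.

Lemma canonical_endo_mul2 x : theta x * s2 = s2 * x.
Proof. by rewrite mulrDl -!mulrA s22 s1s2 !mulr0 add0r mulr1. Qed.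

Lemma phase_mul1 z : phase z * s1 = z^* *: s1.
Proof.
by rewrite mulrDl -!scalerAl -!mulrA s11 s21 mulr0 scaler0 add0r mulr1.
Qed.

Lemma phase_mul2 z : phase z * s2 = z *: s2.
Proof.
by rewrite mulrDl -!scalerAl -!mulrA s22 s1s2 mulr0 scaler0 addr0 mulr1.
Qed.

Lemma phase2_mul1 z : phase2 z * s1 = s1 * phase z^*.
Proof. by rewrite mulrDl -!mulrA s11 s21 !mulr0 add0r mulr1. Qed.

Lemma phase2_mul2 z : phase2 z * s2 = s2 * phase z.
Proof. by rewrite mulrDl -!mulrA s22 s1s2 !mulr0 addr0 mulr1. Qed.

Lemma phaseM z w : phase z * phase w = phase (z * w).
Proof.
apply: eq_cuntz; rewrite -mulrA ?(phase_mul1, phase_mul2) -scalerAr.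
  by rewrite phase_mul1 scalerA rmorphM mulrC.
by rewrite phase_mul2 scalerA mulrC.
Qed.

Lemma phase1 : phase 1 = 1.
Proof. by rewrite /phase rmorph1 !scale1r addrC. Qed.

Lemma phaseJ z : star (phase z) = phase z^*.
Proof. by rewrite starD !starZ !starM !starK. Qed.

Lemma phase2M z w : phase2 z * phase2 w = phase2 (z * w).
Proof.
apply: eq_cuntz; rewrite -mulrA ?(phase2_mul1, phase2_mul2).
  by rewrite mulrA phase2_mul1 -mulrA phaseM rmorphM.
by rewrite mulrA phase2_mul2 -mulrA phaseM.
Qed.

Lemma phase2_1 : phase2 1 = 1.
Proof. by rewrite /phase2 rmorph1 phase1 !mulr1 addrC. Qed.

Lemma phase2J z : star (phase2 z) = phase2 z^*.
Proof. by rewrite starD !starM !starK !phaseJ !mulrA. Qed.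

Lemma canonical_endo_hom : star_hom theta.
Proof.
split=> [a x y||x]; last by rewrite starD !starM !starK !mulrA.
  apply: eq_cuntz; rewrite [RHS]mulrDl -scalerAl ?(canonical_endo_mul1,
    canonical_endo_mul2).
    by rewrite mulrDr -scalerAr.
  by rewrite mulrDr -scalerAr.
split=> [|x y]; first by rewrite /theta !mulr1.
apply: eq_cuntz; rewrite -mulrA ?(canonical_endo_mul1, canonical_endo_mul2)
  !mulrA.
  by rewrite canonical_endo_mul1.
by rewrite canonical_endo_mul2.
Qed.

Lemma iter_canonical_endo_hom n : star_hom (iter n theta).
Proof.
by elim: n => [|n ih];
  [exact: star_hom_id|exact: star_hom_comp canonical_endo_hom ih].
Qed.

(** [theta x] maps each of the two ranges into itself. This is the base case for commutativity of
    the diagonal. *)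
Lemma proj_canonical_endoC x :
  s2 * star s2 * theta x = theta x * (s2 * star s2).
Proof.
apply: eq_cuntz.
  by rewrite -!mulrA canonical_endo_mul1 (mulrA (star s2)) s21 mul0r !mulr0.
by rewrite -!mulrA canonical_endo_mul2 s22 mulr1 canonical_endo_mul2 (mulrA
  (star s2)) s22 mul1r.
Qed.

Lemma diag_subalg_closed : cstar_subalgebra diag_subalg.
Proof. exact: cstar_generated_subalgebra. Qed.

Lemma diag_subalg1 : diag_subalg 1.
Proof. by apply: sub_cstar_generated; left. Qed.

Lemma diag_subalg_proj k : diag_subalg (iter k theta (s2 * star s2)).
Proof. by apply: sub_cstar_generated; right; exists k. Qed.

Lemma diag_subalg_sub (S : set A) :
  cstar_subalgebra S -> S s1 -> S s2 -> diag_subalg `<=` S.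
Proof.
move=> hS S1 S2; have Ss x : S x -> S (star x) by exact: cstar_subalgebra_star.
have SM x y : S x -> S y -> S (x * y) by exact: cstar_subalgebraM.
apply: cstar_generated_min => // _ [->|[k _ <-]].
  by rewrite /= -sum1; apply: cstar_subalgebraD; auto.
by elim: k => [|k ih] /=; [|apply: cstar_subalgebraD]; auto.
Qed.

Lemma diag_subalgC x y : diag_subalg x -> diag_subalg y -> x * y = y * x.
Proof.
apply: cstar_generated_comm => {x y} [_ [->|[k _ <-]]|x y].
- by left; rewrite star1.
- by right; exists k; rewrite // -(star_homS (iter_canonical_endo_hom k)) starM
    starK.
move=> [->|[k _ <-]]; first by rewrite mul1r mulr1.
move=> [->|[l _ <-]]; first by rewrite mul1r mulr1.
(* Common applications of [theta] are stripped until one of the two projections has index 0. *)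
elim: k l => [|k ih] [|l] //=.
- by rewrite proj_canonical_endoC.
- by rewrite proj_canonical_endoC.
- by rewrite -!(star_homM canonical_endo_hom) ih.
Qed.

Lemma diag_subalg_endo x : diag_subalg x -> diag_subalg (theta x).
Proof.
suff : diag_subalg `<=` theta @^-1` diag_subalg by apply.
apply: cstar_generated_min.
  exact: cstar_subalgebra_preimage canonical_endo_hom diag_subalg_closed.
move=> _ [->|[k _ <-]] /=; first by rewrite (star_hom1 canonical_endo_hom);
  exact: diag_subalg1.
exact: diag_subalg_proj k.+1.
Qed.

Lemma diag_subalg_phase z : diag_subalg (phase z).
Proof.
have hD := diag_subalg_closed; have h0 := diag_subalg_proj 0;
  have h1 := diag_subalg1.
rewrite /phase cuntz_proj1; apply: (cstar_subalgebraD hD);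
  apply: (cstar_subalgebraZ _ hD) => //.
exact: (cstar_subalgebraB hD).
Qed.

Lemma diag_subalg_phase2 z : diag_subalg (phase2 z).
Proof.
have hD := diag_subalg_closed.
(* The lowest digit selects [z] or its conjugate, and [theta] makes the phase depend on the second
   digit. *)
have -> : phase2 z =
  s2 * star s2 * theta (phase z) + s1 * star s1 * theta (phase z^*).
  apply: eq_cuntz; rewrite [RHS]mulrDl -!mulrA ?(canonical_endo_mul1,
    canonical_endo_mul2).
    by rewrite phase2_mul1 !(mulrA (star _)) s11 s21 mul1r mul0r mulr0 add0r.
  by rewrite phase2_mul2 !(mulrA (star _)) s22 s1s2 mul1r mul0r mulr0 addr0.
apply: (cstar_subalgebraD hD); apply: (cstar_subalgebraM hD).
- exact: diag_subalg_proj 0.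
- exact: diag_subalg_endo (diag_subalg_phase _).
- rewrite cuntz_proj1; apply: (cstar_subalgebraB hD); first exact: diag_subalg1.
  exact: diag_subalg_proj 0.
- exact: diag_subalg_endo (diag_subalg_phase _).
Qed.

Lemma diag_subalg_iter_phase2 n z : diag_subalg (iter n theta (phase2 z)).
Proof.
by elim: n => [|n ih]; [exact: diag_subalg_phase2|exact: diag_subalg_endo].
Qed.

Lemma diag_subalg_phase_prod (z : nat -> R[i]) n : diag_subalg (phase_prod z n).
Proof.
elim: n => [|n ih]; first exact: diag_subalg1.
exact: (cstar_subalgebraM diag_subalg_closed ih (diag_subalg_iter_phase2 _ _)).
Qed.

(** If [f] fixes a diagonal [x], then [f (theta x)] differs from [theta x] only by [y * x * star y]
    in place of [x], and [y] commutes with [x] and cancels. *)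
Lemma diag_subalg_fixed (f : A -> A) (y : A) :
  star_hom f -> f s2 = s2 -> f s1 = s1 * y -> diag_subalg y -> y * star y = 1 ->
  forall x, diag_subalg x -> f x = x.
Proof.
move=> hf f2 f1 Dy y1.
suff : diag_subalg `<=` [set x | f x = id x] by move=> h x /h.
apply: (cstar_generated_min (cstar_subalgebra_equalizer hf (@star_hom_id _ A))).
move=> _ [->|[k _ <-]] /=; first exact: star_hom1.
elim: k => [|k ih] /=; first by rewrite (star_homM hf) (star_homS hf) f2.
rewrite /theta (star_homD hf) !(star_homM hf) !(star_homS hf) f1 f2 ih starM.
rewrite -!(mulrA s1) (diag_subalgC Dy (diag_subalg_proj k)).
by rewrite -!mulrA (mulrA y) y1 mul1r.
Qed.

(** Splitting off the first factor instead of the last produces, in the limit, the functional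
    equation of the twisting unitary. *)
Lemma phase_prodS (z : nat -> R[i]) n :
  phase_prod z n.+1 = phase2 (z 0) * theta (phase_prod (fun k => z k.+1) n).
Proof.
elim: n => [|n ih].
  by rewrite /= (star_hom1 canonical_endo_hom) mul1r mulr1.
by rewrite [LHS]/= -/(phase_prod z n.+1) ih -mulrA -(star_homM
  canonical_endo_hom).
Qed.

Lemma phase_prodM (z w : nat -> R[i]) n :
  phase_prod z n * phase_prod w n = phase_prod (fun k => z k * w k) n.
Proof.
elim: n => [|n ih] /=; first by rewrite mulr1.
rewrite -ih -phase2M (star_homM (iter_canonical_endo_hom n)).
rewrite -!mulrA; congr (_ * _); rewrite !mulrA; congr (_ * _).
exact: diag_subalgC (diag_subalg_iter_phase2 _ _) (diag_subalg_phase_prod _ _).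
Qed.

Lemma phase_prod_star (z : nat -> R[i]) n :
  star (phase_prod z n) = phase_prod (fun k => (z k)^*) n.
Proof.
elim: n => [|n ih] /=; first exact: star1.
rewrite starM ih -(star_homS (iter_canonical_endo_hom n)) phase2J.
exact: diag_subalgC (diag_subalg_iter_phase2 _ _) (diag_subalg_phase_prod _ _).
Qed.

Lemma phase_prod1 n : phase_prod (fun=> 1) n = 1.
Proof.
elim: n => //= n ->; rewrite phase2_1 mul1r.
exact: star_hom1 (iter_canonical_endo_hom n).
Qed.

(** The factor 4 comes from two nested triangle inequalities over the two ranges; a crude constant
    is enough for geometric convergence. *)
Lemma cnorm_phase2B1 z : cnorm (phase2 z - 1) <= 4 * Normc.normc (z - 1).
Proof.
have n1 : cnorm s1 <= 1 by rewrite cnorm_isometry.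
have n2 : cnorm s2 <= 1 by rewrite cnorm_isometry.
have conj_le (s x : A) : cnorm s <= 1 -> cnorm (s * x * star s) <= cnorm x.
  move=> ns; apply: le_trans (cnorm_mulr_le _ _) _; first by rewrite cnorm_star.
  exact: cnorm_mull_le.
have proj_le (s : A) : cnorm s <= 1 -> cnorm (s * star s) <= 1.
  by move=> ns; have := conj_le s 1 ns; rewrite mulr1 cnorm1.
have nJ w : Normc.normc (w^* - 1) = Normc.normc (w - 1).
  rewrite (_ : w^* - 1 = (w - 1)^*); last by rewrite rmorphB rmorph1.
  by case: (w - 1) => a b; rewrite /Normc.normc /= sqrrN.
have phase_le w : cnorm (phase w - 1) <= 2 * Normc.normc (w - 1).
  have -> : phase w - 1 =
      (w - 1) *: (s2 * star s2) + (w^* - 1) *: (s1 * star s1).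
    by rewrite !scalerBl !scale1r addrACA -opprD [s2 * _ + s1 * _]addrC sum1.
  apply: le_trans (ler_cnormD _ _) _; rewrite !cnormZ nJ.
  rewrite mulr_natl mulr2n; apply: lerD; apply: ler_piMr;
    by [exact: proj_le | case: (w - 1) => *; exact: sqrtr_ge0].
have -> : phase2 z - 1 =
    s2 * (phase z - 1) * star s2 + s1 * (phase z^* - 1) * star s1.
  by rewrite !mulrBr !mulr1 !mulrBl addrACA -opprD [s2 * _ + s1 * star s1]addrC
    sum1.
apply: le_trans (ler_cnormD _ _) _.
have := le_trans (conj_le s2 _ n2) (phase_le z).
have := le_trans (conj_le s1 _ n1) (phase_le z^*).
by rewrite nJ; lra.
Qed.

Lemma phase_prod_unitary (z : nat -> R[i]) n :
  (forall k, z k * (z k)^* = 1) -> unitary_elt (phase_prod z n).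
Proof.
move=> z1; rewrite /unitary_elt phase_prod_star !phase_prodM -(phase_prod1 n).
by split; congr (phase_prod _ n); apply/funext => k; rewrite // mulrC.
Qed.

Lemma phase_flip (f : A -> A) z :
  star_hom f -> f s1 = s2 -> f s2 = s1 -> f (phase z) = phase z^*.
Proof.
move=> hf f1 f2; rewrite /phase (star_homD hf) !(star_homZ hf) !(star_homM hf).
by rewrite !(star_homS hf) f1 f2 conjCK addrC.
Qed.

(** The flip complements all digits, which leaves every [x_k + x_(k+1)] unchanged modulo 2; it also
    commutes with [theta]. *)
Lemma phase_prod_flip (f : A -> A) (z : nat -> R[i]) n :
  star_hom f -> f s1 = s2 -> f s2 = s1 -> f (phase_prod z n) = phase_prod z n.
Proof.
move=> hf f1 f2.
have fphase2 w : f (phase2 w) = phase2 w.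
  rewrite /phase2 (star_homD hf) !(star_homM hf) !(star_homS hf).
  by rewrite !(phase_flip _ hf f1 f2) f1 f2 conjCK addrC.
have ftheta x : f (theta x) = theta (f x).
  rewrite /theta (star_homD hf) !(star_homM hf) !(star_homS hf).
  by rewrite f1 f2 addrC.
elim: n => [|n ih] /=; first exact: star_hom1.
rewrite (star_homM hf) ih; congr (_ * _).
by move: (z n) => w {ih}; elim: n => [|n ih] /=; rewrite ?fphase2 // ftheta ih.
Qed.

(* [w] is the infinite product for the shifted sequence [fun n => z n.+1]; its
   square is the infinite product for [z]. *)
Lemma phase_prod_limit (z : nat -> R[i]) (K q : R) :
  0 <= q < 1 ->
  (forall n, z n * (z n)^* = 1) -> (forall n, z n.+1 * z n.+1 = z n) ->
  (forall n, Normc.normc (z n - 1) <= K * q ^+ n) ->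
  exists w : A, [/\ unitary_elt w, diag_subalg w, w * w = phase2 (z 0) * theta
    w &
    forall f, star_hom f -> f s1 = s2 -> f s2 = s1 -> f w = w].
Proof.
move=> q01 z1 zS zq; pose z' n := z n.+1; pose P := phase_prod z'.
have uP n : unitary_elt (P n) by apply: phase_prod_unitary => k; exact: z1.
have [w Pw] : exists w : A, cnorm_cvg P w.
  (* The extra [q] in the constant accounts for the shifted index in [z']. *)
  apply: (@cnorm_geometric_cvg _ _ _ (4 * (K * q)) q) => // n.
  have -> : P n.+1 = P n * iter n theta (phase2 (z' n)) by [].
  rewrite -{2}[P n]mulr1 -mulrBr.
  have Pn : cnorm (P n) <= 1 by rewrite cnorm_isometry //; case: (uP n).
  apply: le_trans (cnorm_mull_le _ Pn) _.
  have hn := iter_canonical_endo_hom n.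
  rewrite -[X in _ - X](star_hom1 hn) -(star_homB hn).
  apply: le_trans (cnorm_star_hom _ hn) _; apply: le_trans (cnorm_phase2B1 _) _.
  by rewrite -mulrA ler_wpM2l // -mulrA -exprS zq.
have PP n : P n * P n = phase_prod z n.
  by rewrite phase_prodM; congr (phase_prod _ n); apply/funext => k; exact: zS.
exists w; split.
- split; [have h := cnorm_cvgM (cnorm_cvg_star Pw) Pw|
          have h := cnorm_cvgM Pw (cnorm_cvg_star Pw)];
    apply: (cnorm_cvg_unique h); apply: eq_cnorm_cvg (cnorm_cvg_cst 1) => n;
    by case: (uP n).
- apply: (cstar_subalgebra_cvg diag_subalg_closed) Pw => n.
  exact: diag_subalg_phase_prod.
- apply: (cnorm_cvg_unique (cnorm_cvgS (cnorm_cvgM Pw Pw))).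
  (* The squares of the [P n.+1] are the products for [z], which [phase_prodS] rewrites through
     [P n]. *)
  have := cnorm_cvgMl (phase2 (z 0)) (star_hom_cvg canonical_endo_hom Pw).
  by apply: eq_cnorm_cvg => n; rewrite PP phase_prodS.
- move=> f hf f1 f2; apply: (cnorm_cvg_unique (star_hom_cvg hf Pw)).
  by apply: eq_cnorm_cvg Pw => n; rewrite phase_prod_flip.
Qed.

End CuntzPair.

(** * ** Iterated square roots on the unit circle *)

(** If [c] and [s] are the cosine and sine of an angle, then [d] and [s / (2 * d)] are those of its
    half; [0 <= c] keeps [d] away from 0. *)
Lemma half_angle (R : realType) (c s : R) (d : R := Num.sqrt ((1 + c) / 2)) :
  0 <= c -> c ^+ 2 + s ^+ 2 = 1 ->
  [/\ 1 / 2 <= d, d ^+ 2 + (s / (2 * d)) ^+ 2 = 1,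
      d ^+ 2 - (s / (2 * d)) ^+ 2 = c & 2 * (d * (s / (2 * d))) = s].
Proof.
move=> c0 cs; have cp : 0 < (1 + c) / 2 by lra.
have d0 : 0 < d by rewrite sqrtr_gt0.
have dd : d ^+ 2 = (1 + c) / 2 by rewrite sqr_sqrtr // ltW.
clearbody d.
have tt : (s / (2 * d)) ^+ 2 = (1 - c) / 2.
  have -> : (s / (2 * d)) ^+ 2 = s ^+ 2 / (4 * d ^+ 2) by field;
    exact: lt0r_neq0.
  rewrite dd (_ : s ^+ 2 = (1 - c) * (1 + c)); last by rewrite -[in RHS]cs; nra.
  by field; lra.
rewrite tt dd; split; [nra|by field|by field|by field; exact: lt0r_neq0].
Qed.

(* [z_(n+1)] is the square root of [z_n] in the right half plane, starting
   from [z_0 = 'i]. *)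
Lemma dyadic_roots_of_i (R : realType) : exists z : nat -> R[i],
  [/\ z 0%N = 'i, forall n, z n * (z n)^* = 1, forall n, z n.+1 * z n.+1 = z n &
    forall n, Normc.normc (z n - 1) <= 2 * (2 / 3) ^+ n].
Proof.
pose h (w : R[i]) : R[i] :=
  let c := Num.sqrt ((1 + complex.Re w) / 2) in (c +i* (complex.Im w / (2 *
    c)))%C.
pose z n := iter n h 'i%C.
have inv n : 0 <= complex.Re (z n) /\ complex.Re (z n) ^+ 2 + complex.Im (z n)
  ^+ 2 = 1.
  elim: n => [|n [c0 cs]] /=; first by rewrite expr0n expr1n add0r.
  by rewrite sqrtr_ge0; have [] := half_angle c0 cs.
have sqr n : z n.+1 * z n.+1 = z n.
  have [c0 cs] := inv n; have [_ _ e1 e2] := half_angle c0 cs.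
  rewrite (_ : z n.+1 = h (z n)) // /h; move: (Num.sqrt _) e1 e2 => d.
  case: (z n) => c s /= e1 e2.
  apply/eqP; rewrite eq_complex /= -!expr2 e1 eqxx /=; apply/eqP.
  by rewrite -[RHS]e2; ring.
exists z; split=> // n.
  have [_ cs] := inv n; case: (z n) cs => c s /= cs.
  by apply/eqP; rewrite eq_complex /=; apply/andP; split; apply/eqP; nra.
elim: n => [|n ih].
  rewrite expr0 mulr1 /Normc.normc /= !sub0r subr0 sqrrN !expr1n.
  by rewrite -(@ger0_norm _ 2) // -sqrtr_sqr ler_wsqrtr //; lra.
have [c0 cs] := inv n; have [d2 _ _ _] := half_angle c0 cs.
(* The real part of [z n.+1 + 1] is at least 3/2, and its product with [z n.+1 - 1] is [z n - 1];
   hence the ratio 2/3. *)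
have : 3 / 2 <= Normc.normc (z n.+1 + 1).
  rewrite (_ : z n.+1 = h (z n)) // /h /Normc.normc /=;
    move: (Num.sqrt _) d2 => d d2.
  rewrite -(@ger0_norm _ (3 / 2)); last by lra.
  by rewrite -sqrtr_sqr ler_wsqrtr //; nra.
have := Normc.normcM (z n.+1 - 1) (z n.+1 + 1).
have -> : (z n.+1 - 1) * (z n.+1 + 1) = z n - 1.
  by rewrite -(sqr n); ring.
move: ih; rewrite exprS; move: (_ ^+ n) => t.
have : 0 <= Normc.normc (z n.+1 - 1)
  by case: (z n.+1 - 1) => *; exact: sqrtr_ge0.
move: (Normc.normc (z n - 1)) (Normc.normc (z n.+1 - 1)) (Normc.normc _).
move=> a b e.
by nra.
Qed.

(** * Compressions by powers of s_2 *)

Inductive lin_span (K : nzRingType) (V : lmodType K) (G : set V) : set V :=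
| lin_span0 : lin_span G 0
| lin_span_cons a x y : G x -> lin_span G y -> lin_span G (a *: x + y).

Lemma lin_span_linear (K : nzRingType) (V : lmodType K) (G : set V) a x y :
  lin_span G x -> lin_span G y -> lin_span G (a *: x + y).
Proof.
move=> hx hy; elim: hx => {x} [|b x z Gx _ ih]; first by rewrite scaler0 add0r.
by rewrite scalerDr scalerA -addrA; apply: lin_span_cons.
Qed.

Lemma lin_span_gen (K : nzRingType) (V : lmodType K) (G : set V) x :
  G x -> lin_span G x.
Proof.
by move=> Gx; rewrite -[x]addr0 -[x]scale1r; apply: lin_span_cons => //;
  apply: lin_span0.
Qed.

Section UnitaryPowers.
Context {R : realType} {A : cstarAlgType R} (u s2 : A).
Hypothesis Q2r : Q2_relations u s2.
Local Notation s1 := (u * s2).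

Let uu : star u * u = 1. Proof. by case: Q2r => -[]. Qed.
Let uuV : u * star u = 1. Proof. by case: Q2r => -[]. Qed.
Let s22 : star s2 * s2 = 1. Proof. by case: Q2r. Qed.
Let s2u : s2 * u = u * (u * s2). Proof. by case: Q2r => _ _ -> _;
  rewrite mulrA. Qed.

Lemma Q2_cuntz : cuntz_pair s1 s2.
Proof.
case: Q2r => _ _ _ h; split => //; last by rewrite -h starM !mulrA addrC.
by rewrite /isometry_elt starM -mulrA (mulrA _ u) uu mul1r.
Qed.

Let s2s1 : star s2 * s1 = 0. Proof. exact: cuntz_orthol Q2_cuntz. Qed.
Let s1s2 : star s1 * s2 = 0. Proof. exact: cuntz_orthor Q2_cuntz. Qed.
Let s11 : star s1 * s1 = 1. Proof. by case: Q2_cuntz. Qed.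

Definition upow (a : int) : A :=
  match a with Posz n => u ^+ n | Negz n => star u ^+ n.+1 end.

Lemma upowS a : upow (a + 1) = u * upow a.
Proof.
case: a => [n|[|n]]; first by rewrite -PoszD addn1 /= exprS.
  by rewrite /= uuV.
have -> : Negz n.+1 + 1 = Negz n by lia.
by rewrite /= [in RHS]exprS mulrA uuV mul1r.
Qed.

Lemma upowB1 a : upow (a - 1) = star u * upow a.
Proof. by rewrite -[a in RHS](subrK 1) upowS mulrA uu mul1r. Qed.

(** Translating by [c] and then doubling is doubling and then translating by [2c]. Negative
    exponents rest on [s2 * star u = star u * (star u * s2)], obtained by cancelling [u] in the
    defining relation. *)
Lemma mul_s2_upow c : s2 * upow c = upow (c + c) * s2.
Proof.
elim: c => [|n ih|n ih]; first by rewrite mulr1 mul1r.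
  have -> : n.+1%:Z = n%:Z + 1 by lia.
  rewrite upowS mulrA s2u -!mulrA ih.
  have -> : n%:Z + 1 + (n%:Z + 1) = n%:Z + n%:Z + 1 + 1 by lia.
  by rewrite !upowS !mulrA.
have -> : - n.+1%:Z = - n%:Z - 1 by lia.
have s2uV : s2 * star u = star u * (star u * s2).
  have -> : star u * (star u * s2) = star u * (star u * (s2 * u)) * star u.
    by rewrite -!mulrA uuV mulr1.
  by rewrite s2u; do 2!rewrite (mulrA (star u) u) uu mul1r.
rewrite upowB1 mulrA s2uV -!mulrA ih.
have -> : - n%:Z - 1 + (- n%:Z - 1) = - n%:Z + - n%:Z - 1 - 1 by lia.
by rewrite !upowB1 !mulrA.
Qed.

Lemma compress_upow_even c : star s2 * upow (c + c) * s2 = upow c.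
Proof. by rewrite -mulrA -mul_s2_upow mulrA s22 mul1r. Qed.

Lemma compress_upow_odd c : star s2 * upow (c + c + 1) * s2 = 0.
Proof.
by rewrite upowS -!mulrA -mul_s2_upow !mulrA -(mulrA (star s2)) s2s1 mul0r.
Qed.

Lemma int_half (a : int) : exists c, a = c + c \/ a = c + c + 1.
Proof. by exists (a %/ 2)%Z; lia. Qed.

(** Each compression by [s2] halves an even exponent and kills an odd one; a nonzero [a] below
    [2 ^ n] in absolute value becomes odd within [n] steps. *)
Lemma compress_upow_eq0 n a : a != 0 -> (`|a| < 2 ^ n)%N ->
  star s2 ^+ n * upow a * s2 ^+ n = 0.
Proof.
elim: n a => [|n ih] a a0 an; first by lia.
rewrite exprSr exprS -!mulrA (mulrA (upow a)) (mulrA (star s2)) (mulrA (star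
  s2)).
have [c [ac|ac]] := int_half a; rewrite ac.
  rewrite compress_upow_even mulrA ih //; first by lia.
  by move: an; rewrite expnS; lia.
by rewrite compress_upow_odd mul0r mulr0.
Qed.

Lemma s2_starX n : star s2 ^+ n * s2 ^+ n = 1.
Proof.
elim: n => [|n ih]; first by rewrite mulr1.
by rewrite exprSr exprS -mulrA (mulrA (star s2)) s22 mul1r.
Qed.

(** The inner product reduces to a power of [s2] or of [star s2]; orthogonality of [s1] and [s2]
    kills its corner unless [i = j]. *)
Lemma corner_s2X i j :
  exists l : R[i], star s1 * (star s2 ^+ i * s2 ^+ j) * s1 = l *: 1.
Proof.
have [ij|ji] := leqP i j.
  rewrite -(subnKC ij) exprD (mulrA (star s2 ^+ i)) s2_starX mul1r.
  case: (j - i)%N => [|k]; first by exists 1; rewrite mulr1 s11 scale1r.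
  by exists 0; rewrite exprS (mulrA (star s1)) s1s2 !mul0r scale0r.
rewrite -(subnK (ltnW ji)) exprD -(mulrA (star s2 ^+ _)) s2_starX mulr1.
have := ji; rewrite -subn_gt0; case: (i - j)%N => [|k] // _.
by exists 0; rewrite exprSr -(mulrA (star s1)) -(mulrA _ _ s1) s2s1 !mulr0
  scale0r.
Qed.

Definition s2_monomials : set A :=
  [set y | exists b m, y = upow b * s2 ^+ m].

Lemma lin_span_mul_s2X y k :
  lin_span s2_monomials y -> lin_span s2_monomials (y * s2 ^+ k).
Proof.
elim=> [|a _ z [b [m ->]] _ ih]; first by rewrite mul0r; apply: lin_span0.
rewrite mulrDl -scalerAl -mulrA -exprD; apply: lin_span_cons => //.
by exists b, (m + k)%N.
Qed.

(** Terms with [b = 0] have scalar corners, and those with [b != 0] vanish after enough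
    compressions. The exponents [n] and [k] are independent because [y] may already carry powers of
    [s2] on its right. *)
Lemma corner_lin_span y : lin_span s2_monomials y ->
  exists M, forall n k, (M <= n)%N -> (M <= k)%N ->
    exists l : R[i], star s1 * (star s2 ^+ n * y * s2 ^+ k) * s1 = l *: 1.
Proof.
elim=> [|a _ z [b [m ->]] _ [M hM]].
  by exists 0%N => n k _ _; exists 0; rewrite mulr0 mul0r mulr0 mul0r scale0r.
have [M' hM'] : exists M, forall n k, (M <= n)%N -> (M <= k)%N ->
    exists l : R[i],
      star s1 * (star s2 ^+ n * (upow b * s2 ^+ m) * s2 ^+ k) * s1 = l *: 1.
  have [->|b0] := eqVneq b 0.
    exists 0%N => n k _ _; rewrite mul1r -(mulrA (star s2 ^+ n)) -exprD.
    exact: corner_s2X.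
  exists `|b|%N => n k bn bk; exists 0; rewrite scale0r.
  have b2 : (`|b| < 2 ^ `|b|)%N by rewrite ltn_expl.
  (* Exactly [|b|] factors are taken next to [upow b] on each side, which suffices since
     [|b| < 2 ^ |b|]. *)
  rewrite -(subnK bn) -(mulrA _ _ (s2 ^+ k)) -(mulrA (upow b)) -exprD.
  rewrite -(subnKC (leq_trans bk (leq_addl m k))) !exprD !mulrA.
  rewrite -(mulrA _ _ (upow b)) -(mulrA _ _ (s2 ^+ `|b|)).
  by rewrite (compress_upow_eq0 b0 b2) mulr0 !mul0r.
exists (maxn M M') => n k; rewrite !geq_max => /andP[Mn M'n] /andP[Mk M'k].
have [l hl] := hM _ _ Mn Mk; have [l' hl'] := hM' _ _ M'n M'k.
exists (a * l' + l); rewrite scalerDl -scalerA -hl -hl'.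
by rewrite !(mulrDr, mulrDl) -!(scalerAl, scalerAr).
Qed.

(** Factors [star s2] in [x] are absorbed by enough factors [s2] on the right. Quantifying over all
    [a] makes the property stable under products. *)
Definition eventually_monomial (x : A) : Prop :=
  forall a, exists N, lin_span s2_monomials (x * upow a * s2 ^+ N).

Lemma eventually_monomialM x y :
  eventually_monomial x -> eventually_monomial y -> eventually_monomial (x * y).
Proof.
move=> hx hy a; have [N hN] := hy a.
(* [y * upow a * s2 ^+ N] is a finite combination of terms [upow b * s2 ^+ m]; the property of [x]
   is applied for each [b], and the exponents needed are added up. *)
have [K hK] : exists K,
    lin_span s2_monomials (x * (y * upow a * s2 ^+ N) * s2 ^+ K).
  elim: hN => [|c _ z [b [m ->]] _ [K hK]].
    by exists 0%N; rewrite mulr0 mul0r; apply: lin_span0.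
  have [N' hN'] := hx b; exists (N' + K)%N.
  rewrite mulrDr mulrDl -scalerAr -scalerAl; apply: lin_span_linear.
    rewrite -!mulrA -!exprD addnC -addnA exprD !mulrA.
    exact: lin_span_mul_s2X.
  by rewrite addnC exprD mulrA; apply: lin_span_mul_s2X.
by exists (N + K)%N; rewrite exprD -!mulrA in hK *.
Qed.

Lemma eventually_monomial_linear a x y :
  eventually_monomial x -> eventually_monomial y ->
  eventually_monomial (a *: x + y).
Proof.
move=> hx hy b; have [N hN] := hx b; have [N' hN'] := hy b.
exists (N + N')%N; rewrite !mulrDl -!scalerAl; apply: lin_span_linear.
  by rewrite exprD mulrA; apply: lin_span_mul_s2X.
by rewrite addnC exprD mulrA; apply: lin_span_mul_s2X.
Qed.

Lemma eventually_monomial0 : eventually_monomial 0.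
Proof. by move=> a; exists 0%N; rewrite !mul0r; apply: lin_span0. Qed.

Lemma eventually_monomial_gen x : [set u; s2] x ->
  eventually_monomial x /\ eventually_monomial (star x).
Proof.
move=> [->|->]; split=> a.
- by exists 0%N; apply: lin_span_gen; exists (a + 1), 0%N; rewrite upowS.
- by exists 0%N; apply: lin_span_gen; exists (a - 1), 0%N; rewrite upowB1.
- exists 0%N; apply: lin_span_gen; exists (a + a), 1%N.
  by rewrite mul_s2_upow mulr1.
have [c [->|->]] := int_half a; exists 1%N.
  by apply: lin_span_gen; exists c, 0%N; rewrite compress_upow_even mulr1.
by rewrite compress_upow_odd; apply: lin_span0.
Qed.

(* [v] equals [star s2 ^+ n * v * s2 ^+ n] for all [n], and this compression
   maps a given *-polynomial in [u] and [s2] into the span of the powers of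
   [s2] and [star s2] once [n] is large; the [s1]-corner of such an element is
   a scalar, so that of [v] is a limit of scalars. *)
Lemma corner_central v : cstar_generated [set u; s2] = setT ->
  v * s2 = s2 * v -> forall y, star s1 * v * s1 * y = y * (star s1 * v * s1).
Proof.
move=> gen vs2 y.
have near_scalar e : 0 < e ->
    exists l : R[i], cnorm (star s1 * v * s1 - l *: 1) < e.
  (* Both [x] and [star x] are required, so that [P] is closed under [star] by construction. *)
  move=> e0; pose P := [set x : A | eventually_monomial x /\
    eventually_monomial (star x)].
  have hP : cstar_generated [set u; s2] `<=`
      [set x | forall e : R, 0 < e -> exists2 y, P y & cnorm (x - y) < e].
    apply: cstar_generated_min => [|x /eventually_monomial_gen Px d d0];
      last first.
      by exists x; rewrite // subrr cnorm0.
    apply: cstar_subalgebra_closure =>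
      [|a x z [x1 x2] [z1 z2]|x z [x1 x2] [z1 z2]|x [x1 x2]].
    - by split; rewrite ?star0; exact: eventually_monomial0.
    - by rewrite /P /= star_semilinear; split;
        exact: eventually_monomial_linear.
    - by rewrite /P /= starM; split; exact: eventually_monomialM.
    - by rewrite /P /= starK.
  have [x [Px _] vx] : exists2 x, P x & cnorm (v - x) < e by apply: hP;
    rewrite ?gen.
  have [N] := Px 0; rewrite mulr1 => /corner_lin_span[M hM].
  (* With the [N] factors already to the right of [x], both sides carry [N + M] factors, and the
     compression is symmetric. *)
  have [l hl] := hM (N + M)%N M (leq_addl _ _) (leqnn _).
  exists l; rewrite -hl -(mulrA (star s2 ^+ _)) -(mulrA x) -exprD.
  have vX n : s2 ^+ n * v = v * s2 ^+ n.
    elim: n => [|n ih]; first by rewrite mulr1 mul1r.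
    by rewrite exprS -mulrA ih !mulrA vs2.
  have {1}-> : v = star s2 ^+ (N + M) * (v * s2 ^+ (N + M)).
    by rewrite -vX mulrA s2_starX mul1r.
  have s1n : cnorm s1 <= 1 by rewrite cnorm_isometry.
  have s1n' : cnorm (star s1) <= 1 by rewrite cnorm_star.
  have s2n k : cnorm (s2 ^+ k) <= 1.
    rewrite cnorm_isometry // /isometry_elt.
    suff -> : star (s2 ^+ k) = star s2 ^+ k by exact: s2_starX.
    by elim: k => [|k ih]; rewrite ?star1 // exprS starM ih exprSr.
  have s2n' k : cnorm (star s2 ^+ k) <= 1.
    suff <- : star (s2 ^+ k) = star s2 ^+ k by rewrite cnorm_star.
    by elim: k => [|k ih]; rewrite ?star1 // exprS starM ih exprSr.
  rewrite -mulrBl -mulrBr -mulrBr -mulrBl.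
  apply: le_lt_trans vx; apply: le_trans (cnorm_mulr_le _ s1n) _.
  apply: le_trans (cnorm_mull_le _ s1n') _;
    apply: le_trans (cnorm_mull_le _ (s2n' _)) _.
  exact: cnorm_mulr_le.
apply/eqP; rewrite -subr_eq0; apply/eqP; apply: cnorm_le_eq0 => e e0.
set c := star s1 * v * s1.
have y0 : 0 < 1 + cnorm y by have := cnorm_ge0 y; lra.
(* The commutator with [y] does not change when a scalar is subtracted from [c], so it is at most
   [2 * cnorm y] times the distance to that scalar. *)
have [|l hl] := near_scalar (e / 2 / (1 + cnorm y)); first by rewrite !divr_gt0.
rewrite -/c ltr_pdivlMr // in hl.
have -> : c * y - y * c = (c - l *: 1) * y + y * (l *: 1 - c).
  by rewrite mulrBl mulrBr -scalerAl -scalerAr mul1r mulr1 addrA subrK.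
apply: le_trans (ler_cnormD _ _) _.
have := ler_cnormM (c - l *: 1) y; have := ler_cnormM y (l *: 1 - c).
rewrite [cnorm (l *: 1 - c)]cnormB.
by have := cnorm_ge0 (c - l *: 1); have := cnorm_ge0 y; nra.
Qed.

End UnitaryPowers.

(** * Automorphisms of Q_2 *)

Lemma star_hom_Ad (R : realType) (A : cstarAlgType R) (w : A) :
  unitary_elt w -> star_hom (fun x => star w * x * w).
Proof.
move=> [w1 w2]; split=> [a x y||x]; last by rewrite !starM starK mulrA.
  by rewrite mulrDr mulrDl -scalerAr -scalerAl.
split=> [|x y]; first by rewrite mulr1.
by rewrite !mulrA -(mulrA _ w (star w)) w2 mulr1.
Qed.

Lemma unitary_star (R : realType) (A : cstarAlgType R) (w : A) :
  unitary_elt w -> unitary_elt (star w).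
Proof. by move=> [w1 w2]; split; rewrite starK. Qed.

Lemma unitaryM (R : realType) (A : cstarAlgType R) (v w : A) :
  unitary_elt v -> unitary_elt w -> unitary_elt (v * w).
Proof.
move=> [v1 v2] [w1 w2]; split; rewrite starM mulrA.
  by rewrite -(mulrA _ _ v) v1 mulr1.
by rewrite -(mulrA v) w2 mulr1.
Qed.

Lemma unitary_intertwine_star (R : realType) (A : cstarAlgType R) (v w x : A) :
  unitary_elt v -> unitary_elt w -> v * x = x * w -> star v * x = x * star w.
Proof.
move=> [v1 _] [_ w2] e.
by rewrite -[x in LHS]mulr1 -w2 !mulrA -(mulrA (star v)) -e !mulrA v1 mul1r.
Qed.

Lemma unitary_lreg (R : realType) (A : cstarAlgType R) (w : A) :
  unitary_elt w -> injective ( *%R w).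
Proof. by move=> [w1 _] x y e; rewrite -[x]mul1r -[y]mul1r -w1 -!mulrA e. Qed.

Lemma unitary_rreg (R : realType) (A : cstarAlgType R) (w : A) :
  unitary_elt w -> injective ( *%R^~ w).
Proof. by move=> [_ w1] x y /= e; rewrite -[x]mulr1 -[y]mulr1 -w1 !mulrA e. Qed.

(** Conjugation by [x |-> -1 - x] turns [x |-> x + 1] into [x |-> x - 1] and [x |-> 2 x] into
    [x |-> 2 x + 1]. *)
Lemma Q2_relations_flip (R : realType) (A : cstarAlgType R) (u s2 : A) :
  Q2_relations u s2 -> Q2_relations (star u) (u * s2).
Proof.
move=> h; have [hu hs su sum] := h; have [uu uuV] := hu.
have [h1 _ _] := Q2_cuntz h; split=> //; first exact: unitary_star.
  have s2V : s2 * star u = star u * star u * s2.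
    apply: (unitary_lreg (unitaryM hu hu)).
    rewrite !mulrA -expr2 -su -(mulrA s2) uuV mulr1 expr2.
    by rewrite -(mulrA u u (star u)) uuV mulr1 uuV mul1r.
  by rewrite -mulrA s2V expr2 !mulrA uuV mul1r -(mulrA (star u) (star u)) uu
    mulr1.
rewrite starM starK !mulrA uu mul1r -(mulrA (s2 * star s2)) uu mulr1 addrC.
by rewrite -[RHS]sum.
Qed.

Section Q2Automorphisms.
Context {R : realType} {Q : cstarAlgType R} (u s2 : Q).
Hypothesis hQ : is_Q2 u s2.
Local Notation s1 := (u * s2).
Local Notation diag_subalg := (diag_subalg s1 s2).

Let Q2r : Q2_relations u s2. Proof. by case: hQ. Qed.
Let cp : cuntz_pair s1 s2 := Q2_cuntz Q2r.

Lemma Q2_hom_ext (B : cstarAlgType R) (f g : Q -> B) :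
  star_hom f -> star_hom g -> f u = g u -> f s2 = g s2 -> f =1 g.
Proof.
move=> hf hg fu fs x; have [_ gen _] := hQ.
have : cstar_generated [set u; s2] `<=` [set x | f x = g x].
  apply: cstar_generated_min; first exact: cstar_subalgebra_equalizer.
  by move=> y [->|->].
by apply; rewrite gen.
Qed.

Lemma Q2_hom_exists (v t : Q) :
  Q2_relations v t -> exists f : Q -> Q, [/\ star_hom f, f u = v & f s2 = t].
Proof.
by move=> vt; have [_ _ univ] := hQ; have [f [hf _]] := univ _ _ _ vt; exists f.
Qed.

Lemma O2_subalgebra : cstar_subalgebra (O2 u s2).
Proof. exact: cstar_generated_subalgebra. Qed.

Lemma O2_s1 : O2 u s2 s1.
Proof. by apply: sub_cstar_generated; left. Qed.

Lemma O2_s2 : O2 u s2 s2.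
Proof. by apply: sub_cstar_generated; right. Qed.

Lemma O2_diag_subalg x : diag_subalg x -> O2 u s2 x.
Proof. exact: diag_subalg_sub cp _ O2_subalgebra O2_s1 O2_s2 x. Qed.

Lemma O2_hom_sub (f : Q -> Q) : star_hom f -> O2 u s2 (f s1) -> O2 u s2 (f s2)
  ->
  forall x, O2 u s2 x -> O2 u s2 (f x).
Proof.
move=> hf f1 f2.
suff : O2 u s2 `<=` f @^-1` O2 u s2 by [].
apply: cstar_generated_min;
  first exact: cstar_subalgebra_preimage O2_subalgebra.
by move=> x [->|->].
Qed.

(** Being mutually inverse is tested on the generators. That [g] also maps [O2 u s2] into itself
    makes the image under [f] all of it. *)
Lemma Q2_aut_exists (f g : Q -> Q) : star_hom f -> star_hom g ->
  f (g u) = u -> f (g s2) = s2 -> g (f u) = u -> g (f s2) = s2 ->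
  O2 u s2 (f s1) -> O2 u s2 (f s2) -> O2 u s2 (g s1) -> O2 u s2 (g s2) ->
  exists2 phi : cstar_aut Q, f = phi & aut_stabilizing (O2 u s2) phi.
Proof.
move=> hf hg fgu fgs gfu gfs f1 f2 g1 g2.
have fK : cancel f g.
  exact: (@Q2_hom_ext _ (g \o f) id (star_hom_comp hg hf) (@star_hom_id _ Q)).
have gK : cancel g f.
  exact: (@Q2_hom_ext _ (f \o g) id (star_hom_comp hf hg) (@star_hom_id _ Q)).
exists (CStarAut hf (Bijective fK gK)) => //; rewrite /aut_stabilizing /=.
apply/seteqP; split=> [_ [x Ox <-]|x Ox]; first exact: O2_hom_sub.
by exists (g x); [exact: O2_hom_sub|exact: gK].
Qed.

Lemma flip_aut_exists : exists2 phi : cstar_aut Q,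
  phi u = star u /\ phi s2 = s1 & aut_stabilizing (O2 u s2) phi.
Proof.
have [f [hf fu fs]] := Q2_hom_exists (Q2_relations_flip Q2r).
have uu : star u * u = 1 by case: Q2r => -[].
have f1 : f s1 = s2 by rewrite (star_homM hf) fu fs mulrA uu mul1r.
have [||||||||phi fE Hphi] := @Q2_aut_exists f f hf hf.
- by rewrite fu (star_homS hf) fu starK.
- by rewrite fs f1.
- by rewrite fu (star_homS hf) fu starK.
- by rewrite fs f1.
- by rewrite f1; exact: O2_s2.
- by rewrite fs; exact: O2_s1.
- by rewrite f1; exact: O2_s2.
- by rewrite fs; exact: O2_s1.
by exists phi => //; rewrite -fE.
Qed.

(** Here [y] and [y'] are the functions [W(2x)] and [W(2x+1)], and [y' * y = W] is the
    multiplicative form of [v(2x) + v(2x+1) = v(x)]. The range relation survives because [W]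
    commutes with [s2 * star s2]. *)
Lemma Q2_relations_twist (W y y' : Q) : unitary_elt W -> diag_subalg W ->
  W * s2 = s2 * y -> W * s1 = s1 * y' -> y' * y = W -> Q2_relations (u * W) s2.
Proof.
move=> hW DW W2 W1 yy; have [hu hs su sum] := Q2r.
split=> //; first exact: unitaryM.
- have us1 : u * s1 = s2 * u by rewrite su expr2 mulrA.
  by rewrite expr2 -!mulrA W2 (mulrA u s2) (mulrA W s1) W1 -(mulrA s1) yy
    (mulrA u s1) us1 mulrA.
- have [_ WV] := hW; rewrite starM -!mulrA (mulrA s2) (mulrA W).
  rewrite (diag_subalgC cp DW (diag_subalg_proj 0)) -!mulrA (mulrA W) WV mul1r.
  by rewrite -sum !mulrA.
Qed.

(** The inverse is the twist by [star W]: both twists fix the diagonal, hence [W] itself. [O2 u s2]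
    is preserved because [s1] is multiplied by a diagonal element. *)
Lemma twist_aut_exists (W y y' : Q) : unitary_elt W -> diag_subalg W ->
  unitary_elt y -> diag_subalg y -> unitary_elt y' -> diag_subalg y' ->
  W * s2 = s2 * y -> W * s1 = s1 * y' -> y' * y = W ->
  exists2 phi : cstar_aut Q,
    [/\ phi u = u * W, phi s2 = s2 & forall x, diag_subalg x -> phi x = x] &
    aut_stabilizing (O2 u s2) phi.
Proof.
move=> hW DW hy Dy hy' Dy' W2 W1 yy.
have hD := diag_subalg_closed s1 s2.
have DWV : diag_subalg (star W) := cstar_subalgebra_star hD DW.
have DyV : diag_subalg (star y) := cstar_subalgebra_star hD Dy.
have [f [hf fu fs]] := Q2_hom_exists (Q2_relations_twist hW DW W2 W1 yy).
have [|g [hg gu gs]] := @Q2_hom_exists (u * star W) s2.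
  apply: (@Q2_relations_twist (star W) (star y) (star y')) => //.
  - exact: unitary_star.
  - exact: unitary_intertwine_star.
  - exact: unitary_intertwine_star.
  - by rewrite -starM (diag_subalgC cp Dy Dy') yy.
have f1 : f s1 = s1 * y by rewrite (star_homM hf) fu fs -mulrA W2 mulrA.
have g1 : g s1 = s1 * star y.
  by rewrite (star_homM hg) gu gs -mulrA (unitary_intertwine_star hW hy W2)
    mulrA.
have fD : forall x, diag_subalg x -> f x = x.
  by apply: (diag_subalg_fixed cp hf fs f1 Dy); case: hy.
have gD : forall x, diag_subalg x -> g x = x.
  by apply: (diag_subalg_fixed cp hg gs g1 DyV); rewrite starK; case: hy.
have [WW WWV] := hW.
have [||||||||phi fE Hphi] := @Q2_aut_exists f g hf hg.
- by rewrite gu (star_homM hf) fu fD // -mulrA WWV mulr1.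
- by rewrite gs fs.
- by rewrite fu (star_homM hg) gu gD // -mulrA WW mulr1.
- by rewrite fs gs.
- rewrite f1; apply: (cstar_subalgebraM O2_subalgebra); first exact: O2_s1.
  exact: O2_diag_subalg.
- by rewrite fs; exact: O2_s2.
- rewrite g1; apply: (cstar_subalgebraM O2_subalgebra); first exact: O2_s1.
  exact: O2_diag_subalg.
- by rewrite gs; exact: O2_s2.
by exists phi => //; rewrite -fE.
Qed.

End Q2Automorphisms.

(** * ** Non-commuting outer classes *)

Lemma out_commute_inner (R : realType) (Q : cstarAlgType R) (f g : cstar_aut Q)
  :
  (out_class f * out_class g = out_class g * out_class f)%g ->
  exists2 w, unitary_elt w & forall x, f (g x) = w * g (f x) * star w.
Proof.
rewrite /out_class => e.
have : \pi_(Out Q)%qT (f * g)%g = \pi_(Out Q)%qT (g * f)%g by rewrite !out_piM.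
move=> /out_eqP[w hw fg]; exists w => // x.
by rewrite -fg /= (aut_invP (g * f)%g).1.
Qed.

Theorem theorem1p4 (R : realType) (Q : cstarAlgType R) (u s2 : Q)
    (hQ : is_Q2 u s2) :
  ~ abelian_set (out_class (A := Q) @` aut_stabilizing (O2 u s2)).
Proof.
move=> abel; have [Q2r gen _] := hQ; have cp := Q2_cuntz Q2r.
set s1 := u * s2 in cp; set phs := phase s1 s2; set D := diag_subalg s1 s2.
have [s11 s22 sum1] := cp.
have hD : cstar_subalgebra D by exact: diag_subalg_closed.
have DC x y : D x -> D y -> x * y = y * x by exact: diag_subalgC.
have [z [z0 z1 zS zq]] := dyadic_roots_of_i R.
have q01 : 0 <= (2 / 3 : R) < 1 by lra.
have [w [hw Dw wE wflip]] := phase_prod_limit cp q01 z1 zS zq.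
(* [W] is the infinite product for [z] itself. The existential keeps it opaque to rewriting, as for
   [y] and [y'] below. *)
rewrite z0 in wE; have [W WE] : exists W, W = w * w by exists (w * w).
have iJ : ('i : R[i]) * 'i^* = 1 by rewrite -z0.
have Dphs a : D (phs a) by exact: diag_subalg_phase.
have hphs a : a * a^* = 1 -> unitary_elt (phs a).
  by move=> a1; split; rewrite /phs phaseJ phaseM // ?a1 ?[_ * a]mulrC ?a1
    phase1.
(* On even and odd points the factor [phase2 'i] of [W] contributes [phs 'i] and [phs 'i^*], and
   [theta w] contributes [w]. *)
have [y yE] : exists y, y = phs 'i * w by eexists.
have [y' y'E] : exists y', y' = phs 'i^* * w by eexists.
have W2 : W * s2 = s2 * y.
  by rewrite WE wE yE -mulrA canonical_endo_mul2 // mulrA phase2_mul2 // -mulrA.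
have W1 : W * s1 = s1 * y'.
  by rewrite WE wE y'E -mulrA canonical_endo_mul1 // mulrA phase2_mul1 //
    -mulrA.
have yy : y' * y = W.
  rewrite yE y'E WE -mulrA (mulrA w) (DC w) // !mulrA phaseM // mulrC iJ.
  by rewrite phase1 // mul1r.
have hW : unitary_elt W by rewrite WE; exact: unitaryM.
have DW : D W by rewrite WE; exact: cstar_subalgebraM hD _ _.
have hy : unitary_elt y by rewrite yE; apply: unitaryM => //; exact: hphs.
have Dy : D y by rewrite yE; exact: cstar_subalgebraM hD _ _.
have hy' : unitary_elt y'.
  by rewrite y'E; apply: unitaryM => //; apply: hphs; rewrite conjCK mulrC.
have Dy' : D y' by rewrite y'E; exact: cstar_subalgebraM hD _ _.
have [phi [phiu phis phiD] Ophi] :=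
  twist_aut_exists hQ hW DW hy Dy hy' Dy' W2 W1 yy.
have [F [Fu Fs] OF] := flip_aut_exists hQ.
have hphi := cstar_aut_hom phi; have hF := cstar_aut_hom F.
have [uu uuV] : unitary_elt u by case: Q2r.
have F1 : F s1 = s2 by rewrite (star_homM hF) Fu Fs mulrA uu mul1r.
have phi1 : phi s1 = s1 * y by rewrite (star_homM hphi) phiu phis -mulrA W2
  mulrA.
have Fw : F w = w by exact: wflip.
have FW : F W = W by rewrite WE (star_homM hF) Fw.
have [WW WWV] := hW.
(* The inner automorphism is identified on the generators; on [s2] the identity uses
   [y' * y = W]. *)
have FphiFphi x : F (phi (F (phi x))) = star W * x * W.
  move: x; apply: (Q2_hom_ext hQ
    (star_hom_comp hF (star_hom_comp hphi (star_hom_comp hF hphi)))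
    (star_hom_Ad hW)) => /=.
    rewrite phiu (star_homM hF) FW Fu (star_homM hphi) (phiD _ DW).
    rewrite (star_homS hphi) phiu (star_homM hF) (star_homS hF) (star_homM hF).
    by rewrite FW Fu starM starK.
  have Fy : F y = y' by rewrite yE y'E (star_homM hF) Fw (phase_flip _ hF F1
    Fs).
  rewrite phis Fs phi1 (star_homM hF) F1 Fy.
  have -> : star W * s2 = s2 * star y.
    exact: unitary_intertwine_star.
  rewrite -mulrA -yy (DC y') // [star y * _]mulrA.
  by have [-> _] := hy; rewrite mul1r.
have [|w0 hw0 inn] := @out_commute_inner _ _ phi F.
  by apply: abel; [exists phi|exists F].
(* If the classes commute, [phi (F x)] is [F (phi x)] conjugated by [w0]; with the previous
   identity, [phi] applied twice is conjugation by [v]. *)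
have [v vE] : exists v, v = w0 * star W by eexists.
have hv : unitary_elt v by rewrite vE; apply: unitaryM => //;
  exact: unitary_star.
have [vv vvV] := hv.
have phi2 x : phi (phi x) * v = v * x.
  have FF : F (F (phi x)) = phi x.
    move: (phi x); apply: (Q2_hom_ext hQ (star_hom_comp hF hF) (@star_hom_id _
      Q)) => /=.
      by rewrite Fu (star_homS hF) Fu starK.
    by rewrite Fs F1.
  rewrite -{1}FF inn FphiFphi vE !mulrA.
  have [w01 _] := hw0.
  by rewrite -(mulrA _ (star w0) w0) w01 mulr1 -(mulrA _ W) WWV mulr1.
have vs2 : v * s2 = s2 * v by rewrite -phi2 !phis.
have vs1 : v * s1 = s1 * (y * y * v).
  by rewrite -phi2 phi1 (star_homM hphi) phi1 (phiD _ Dy) !mulrA.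
(* [y * y * v] is the [s1]-corner of [v], by [vs1]. *)
have cen : forall x, y * y * v * x = x * (y * y * v).
  have := corner_central Q2r gen vs2.
  by rewrite -/s1 -mulrA vs1 mulrA s11 mul1r.
have N1 : phs (-1) = -1.
  rewrite /phs /phase rmorphN1 !scaleN1r -opprD.
  by rewrite -[in RHS]sum1 addrC.
have ii : phs 'i * phs 'i = -1 by rewrite phaseM // -expr2 sqrCi.
have y2 : y * y = - W.
  rewrite yE WE -mulrA (mulrA w) (DC w) // !mulrA ii -!mulrA mulN1r //.
(* Up to sign, [W * v] is central; since [v] commutes with [s2] and is invertible, so does [W]. *)
have Ws2 : W * s2 = s2 * W.
  apply: (unitary_rreg hv); apply: oppr_inj.
  by have := cen s2; rewrite y2 !mulNr mulrN -!mulrA vs2.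
have yW : y = W by have := W2; rewrite Ws2 => /(congr1 ( *%R (star s2)));
  rewrite !mulrA s22 !mul1r.
(* Cancelling [w] in [phs 'i * w = w * w] gives [W = -1]. But then [y' = 1], so [W * s1] is both
   [s1] and [- s1]. *)
have wE' : w = phs 'i.
  by move: yW; rewrite yE WE => /(unitary_rreg hw).
have : W * s1 = - s1 by rewrite WE wE' ii mulN1r.
rewrite W1 y'E wE' phaseM // mulrC iJ phase1 // mulr1 => /eqP.
rewrite -addr_eq0 -mulr2n -scaler_nat scaler_eq0 pnatr_eq0 /= => /eqP s10.
by have := s11; rewrite /isometry_elt s10 mulr0 => /eqP;
  rewrite eq_sym oner_eq0.
Qed.
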